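(* Let $\Gamma$ be a group with a hyperbolic action on $X$, and let $h \in \Gamma$ be a loxodromic element of the action. Then the following properties are all equivalent to each other: (1) For every $x \in X$ and $R > 0$ there exists an integer $M \ge 1$ such that any subset $Z \subset \Gamma$ satisfying the following two properties is finite: (a) for each $g \in Z$ we have $d(x,g(x)) < R$ and $d(h^M(x), g h^M(x)) < R$; and (b) no two elements of $Z$ lie in the same left coset of $\mathrm{Stab}(\partial_\pm h)$. (2) The $\Gamma$-orbit of $\partial h$ in the space $\partial^2 X$ is a discrete subset; equivalently, the $\Gamma$-orbit of $\partial_\pm h$ in the space $\partial X \times \partial X - \Delta$ is a discrete subset. (3) For any quasi-axis $\ell$ of $h$ there exists $D \ge 0$ such that for any $g \in \Gamma$, if $g \notin \mathrm{Stab}(\partial h)$ then the image of a closest point map $g(\ell) \to \ell$ has diameter $\le D$. (4)$_\forall$ In the group $\Gamma$ there is no infinite sequence $g_1, g_2, g_3, \ldots$ satisfying both of the following: (a) for all $i \ne j$ the elements $g_i, g_j$ lie in different left cosets of $\mathrm{Stab}(\partial_\pm h)$; and (b) for all $x \in X$ there exists $R > 0$ such that for all $M \ge 0$ there exists $I \ge 0$ such that if $0 \le m \le M$ and $i \ge I$ then $d(g_i h^m(x), h^m(x)) < R$. (4)$_\exists$ In the group $\Gamma$ there is no infinite sequence $g_1, g_2, g_3, \ldots$ satisfying both of the following: (a) for all $i \ne j$ the elements $g_i, g_j$ lie in different left cosets of $\mathrm{Stab}(\partial_\pm h)$; and (b) there exist $x \in X$ and $R > 0$ such that for all $M \ge 0$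 there exists $I \ge 0$ such that if $0 \le m \le M$ and $i \ge I$ then $d(g_i h^m(x), h^m(x)) < R$. A loxodromic element $h$ satisfying these equivalent properties is called WWPD (with respect to the action of $\Gamma$ on $X$). In addition, if $h$ is WWPD then the following hold: (5) $\mathrm{Stab}(\partial_- h) = \mathrm{Stab}(\partial_+ h) = \mathrm{Stab}(\partial_\pm h)$. In particular, for every loxodromic element $\gamma \in \Gamma$, the set $\partial\gamma$ is either equal to or disjoint from $\partial h$. (6) If $k \in \Gamma - \mathrm{Stab}(\partial h)$ then $h$ and $k h k^{-1}$ are independent loxodromic elements.
   Context: A hyperbolic action of a group $\Gamma$ on $X$ is an action by isometries on a geodesic metric space $(X,d)$ that is Gromov hyperbolic; $\partial X$ is the Gromov boundary, and the action extends to $X \cup \partial X$. The group $\Gamma$ acts on $\partial X$, diagonally on $\partial X \times \partial X - \Delta$ ($\Delta$ the diagonal), and on $\partial^2 X = \{\{\xi,\eta\} : \xi \ne \eta \in \partial X\}$, whose topology is induced by the 2-to-1 covering map $\partial X \times \partial X - \Delta \to \partial^2 X$. An isometry $h$ of $X$ is loxodromic if $k \mapsto h^k(x)$ is a quasi-isometric embedding $\mathbb{Z} \to X$ for some (every) $x \in X$. For a loxodromic $h$, $\partial_\pm h = (\partial_- h, \partial_+ h) \in \partial X \times \partial X - \Delta$ is its ordered pair of repelling and attracting fixed points, and $\partial h = \{\partial_- h, \partial_+ h\} \in \partial^2 X$ is the unordered pair. A quasi-axis of $h$ is a continuous quasi-isometric embedding $\ell \colon \mathbb{R} \to X$ such that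 $h(\ell(t)) = \ell(t+T)$ for all $t$, where $T > 0$ is independent of $t$; its image is also denoted $\ell$. A closest point map $g(\ell) \to \ell$ assigns to each point of $g(\ell)$ a point of $\ell$ at minimal distance from it. Stabilizers are taken in $\Gamma$: $\mathrm{Stab}(\partial_- h)$ and $\mathrm{Stab}(\partial_+ h)$ are the stabilizers of the individual points, $\mathrm{Stab}(\partial_\pm h)$ is the stabilizer of the ordered pair, and $\mathrm{Stab}(\partial h)$ is the stabilizer of the unordered pair. Two loxodromic elements $\gamma,\delta$ are independent if $\partial\gamma \cap \partial\delta = \emptyset$. *)

(* Defs.v *)
From HB Require Import structures.
From mathcomp Require Import all_boot all_order all_algebra.
From mathcomp Require Import all_classical all_reals all_analysis.
From mathcomp Require Import ring lra.
Set Implicit Arguments.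
Unset Strict Implicit.
Unset Printing Implicit Defensive.
Import Order.TTheory GRing.Theory Num.Theory.
Import numFieldNormedType.Exports.

Local Open Scope classical_set_scope.
Local Open Scope ring_scope.

Section HyperbolicSpaces.
Context {R : realType} (X : metricType R).
Implicit Types (x y z p : X) (s t : nat -> X).

Definition geodesic_space : Prop :=
  forall x y, exists c : R -> X,
    [/\ c 0 = x, c (mdist x y) = y &
        forall u v, 0 <= u <= mdist x y -> 0 <= v <= mdist x y ->
          mdist (c u) (c v) = `|u - v|].

Definition gromov_product p x y : R :=
  (mdist p x + mdist p y - mdist x y) / 2.

Definition gromov_hyperbolic : Prop :=
  exists delta : R, forall p x y z,
    Num.min (gromov_product p x y) (gromov_product p y z) - delta
      <= gromov_product p x z.

(* Quasi-isometric embedding of a set T with distance function dT. *)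
Definition qi_embedding (T : Type) (dT : T -> T -> R) (f : T -> X) : Prop :=
  exists K C : R, [/\ 1 <= K, 0 <= C &
    forall u v, K^-1 * dT u v - C <= mdist (f u) (f v) <= K * dT u v + C].

Definition diameter (E : set X) : \bar R :=
  ereal_sup [set (mdist q.1 q.2)%:E | q in E `*` E].

(* The Gromov boundary: the space is not assumed proper, so boundary points are
   classes of sequences converging at infinity. *)
Definition asymptotic s t : Prop :=
  forall p, gromov_product p (s ij.1) (t ij.2)
    @[ij --> filter_prod \oo \oo] --> +oo.

Definition converges_at_infinity s : Prop := asymptotic s s.

Definition asymptotic_class s : set (nat -> X) :=
  [set t | converges_at_infinity t /\ asymptotic s t].

Record boundary : Type := Boundary {
  boundary_class :> set (nat -> X);
  boundary_classP : exists2 s, converges_at_infinity s &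
                               boundary_class = asymptotic_class s }.

HB.instance Definition _ := gen_eqMixin boundary.
HB.instance Definition _ := gen_choiceMixin boundary.

Definition boundary_product p (xi eta : boundary) : \bar R :=
  ereal_sup [set limf_einf
      (fun ij : nat * nat => (gromov_product p (st.1 ij.1) (st.2 ij.2))%:E)
      (filter_prod \oo \oo)
    | st in boundary_class xi `*` boundary_class eta].

(* The topology in which the sets {eta | (xi | eta)_p >= r}, r real, form a
   neighbourhood basis of xi, for any base point p. *)
Definition boundary_open (U : set boundary) : Prop :=
  forall xi, U xi -> forall p, exists r : R,
    [set eta | (r%:E <= boundary_product p xi eta)%E] `<=` U.

Lemma boundary_openT : boundary_open setT.
Proof. by move=> xi _ p; exists 0. Qed.

Lemma boundary_openI (U V : set boundary) :
  boundary_open U -> boundary_open V -> boundary_open (U `&` V).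
Proof.
move=> oU oV xi [Ux Vx] p; have [r rU] := oU xi Ux p; have [q qV] := oV xi Vx p.
exists (Num.max r q) => eta /= H; split.
  by apply: rU => /=; apply: le_trans H; rewrite lee_fin le_max lexx.
by apply: qV => /=; apply: le_trans H; rewrite lee_fin le_max lexx orbT.
Qed.

Lemma boundary_open_bigU (I : Type) (F : I -> set boundary) :
  (forall i, boundary_open (F i)) -> boundary_open (\bigcup_i F i).
Proof.
move=> oF xi [i _ Fi] p; have [r rF] := oF i xi Fi p.
by exists r => eta /rF ?; exists i.
Qed.

HB.instance Definition _ := isOpenTopological.Build boundary
  boundary_openT boundary_openI boundary_open_bigU.

Definition boundary_pairs : Type :=
  [set q : boundary * boundary | q.1 <> q.2].

HB.instance Definition _ := Topological.on boundary_pairs.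

Record boundary2 : Type := Boundary2 {
  boundary2_set :> set boundary;
  boundary2_setP : exists xi eta, xi <> eta /\
                     boundary2_set = [set xi; eta] }.

HB.instance Definition _ := gen_eqMixin boundary2.
HB.instance Definition _ := gen_choiceMixin boundary2.

Lemma unordered_subproof (e : boundary_pairs) : exists xi eta, xi <> eta /\
  [set (val e).1; (val e).2] = [set xi; eta].
Proof.
by exists (val e).1, (val e).2; split => //; have := valP e; rewrite inE.
Qed.

Definition unordered (e : boundary_pairs) : boundary2 :=
  Boundary2 (unordered_subproof e).

(* Quotient topology along the 2-to-1 map [unordered]. *)
Definition boundary2_open (U : set boundary2) : Prop :=
  open (unordered @^-1` U).

Lemma boundary2_openT : boundary2_open setT.
Proof. by rewrite /boundary2_open preimage_setT; exact: openT. Qed.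

Lemma boundary2_openI (U V : set boundary2) :
  boundary2_open U -> boundary2_open V -> boundary2_open (U `&` V).
Proof. exact: openI. Qed.

Lemma boundary2_open_bigU (I : Type) (F : I -> set boundary2) :
  (forall i, boundary2_open (F i)) -> boundary2_open (\bigcup_i F i).
Proof.
by move=> oF; rewrite /boundary2_open preimage_bigcup; apply: bigcup_open => i _; exact: oF.
Qed.

HB.instance Definition _ := isOpenTopological.Build boundary2
  boundary2_openT boundary2_openI boundary2_open_bigU.

End HyperbolicSpaces.
Section BoundaryFacts.
Context {R : realType} {X : metricType R}.
Implicit Types (x y z p : X) (s t : nat -> X).

Lemma asymptoticP s t : asymptotic s t <-> forall p (B : R), exists N : nat,
  forall i j, (N <= i)%N -> (N <= j)%N -> B <= gromov_product p (s i) (t j).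
Proof.
split=> [H p B|H p].
  have /cvgryPge/(_ B) := H p.
  case=> -[P Q] /= [[n _ nP] [m _ mQ]] PQ.
  exists (maxn n m) => i j; rewrite !geq_max => /andP[ni _] /andP[_ mj].
  by apply: (PQ (i, j)); split; [exact: nP|exact: mQ].
apply/cvgryPge => B; have [N HN] := H p B.
exists ([set n | (N <= n)%N], [set n | (N <= n)%N]) => /=.
  by split; exists N => //.
by move=> [i j] [/= Ni Nj]; exact: HN.
Qed.

Lemma gromov_productC p x y : gromov_product p x y = gromov_product p y x.
Proof. by rewrite /gromov_product (metric_sym x y) (addrC (mdist p x)). Qed.

Lemma asymptotic_sym s t : asymptotic s t -> asymptotic t s.
Proof.
move=> /asymptoticP H; apply/asymptoticP => p B; have [N HN] := H p B.
by exists N => i j Ni Nj; rewrite gromov_productC; exact: HN.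
Qed.

Lemma asymptotic_trans s t u : gromov_hyperbolic X ->
  asymptotic s t -> asymptotic t u -> asymptotic s u.
Proof.
move=> [d Hd] /asymptoticP st /asymptoticP tu; apply/asymptoticP => p B.
have [N HN] := st p (B + d); have [M HM] := tu p (B + d).
exists (maxn N M) => i j; rewrite !geq_max => /andP[Ni Mi] /andP[Nj Mj].
apply: le_trans (Hd p (s i) (t (maxn N M)) (u j)).
rewrite lerBrDr le_min HN ?HM ?leq_maxl ?leq_maxr //.
Qed.

Lemma asymptotic_class_eq s t : gromov_hyperbolic X ->
  asymptotic s t -> asymptotic_class s = asymptotic_class t.
Proof.
move=> hX st; apply/seteqP; split=> u [cu su]; split => //.
  exact: asymptotic_trans hX (asymptotic_sym st) su.
exact: asymptotic_trans hX st su.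
Qed.

Lemma boundary_eq (xi eta : boundary X) :
  boundary_class xi = boundary_class eta -> xi = eta.
Proof.
case: xi eta => [E HE] [F HF] /= EF; rewrite -EF in HF *.
by congr Boundary; exact: Prop_irrelevance.
Qed.

Lemma boundary2_eq (e f : boundary2 X) :
  boundary2_set e = boundary2_set f -> e = f.
Proof.
case: e f => [E HE] [F HF] /= EF; rewrite -EF in HF *.
by congr Boundary2; exact: Prop_irrelevance.
Qed.

End BoundaryFacts.

Record hyperbolic_action (R : realType) (G : groupType) (X : metricType R) :
    Type := HyperbolicAction {
  hact :> G -> X -> X;
  hact1 : forall x, hact 1%g x = x;
  hactM : forall g k x, hact (g * k)%g x = hact g (hact k x);
  hact_isometry : forall g x y, mdist (hact g x) (hact g y) = mdist x y;
  hact_geodesic : geodesic_space X;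
  hact_hyperbolic : gromov_hyperbolic X }.

Section HyperbolicActions.
Context {R : realType} {G : groupType} {X : metricType R}.
Variable A : hyperbolic_action G X.
Implicit Types (g h k : G) (x y p : X).

Lemma hactK g : cancel (A g) (A g^-1%g).
Proof. by move=> x; rewrite -hactM mulVg hact1. Qed.

Lemma hactVK g : cancel (A g^-1%g) (A g).
Proof. by move=> x; rewrite -hactM mulgV hact1. Qed.

Lemma gromov_product_act g p x y :
  gromov_product (A g p) (A g x) (A g y) = gromov_product p x y.
Proof. by rewrite /gromov_product !hact_isometry. Qed.

Lemma asymptotic_act g (s t : nat -> X) :
  asymptotic (A g \o s) (A g \o t) <-> asymptotic s t.
Proof.
split=> /asymptoticP H; apply/asymptoticP => p B.
  have [N HN] := H (A g p) B; exists N => i j Ni Nj.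
  by have := HN i j Ni Nj; rewrite gromov_product_act.
have [N HN] := H (A g^-1%g p) B; exists N => i j Ni Nj.
by rewrite -(hactVK g p) /= gromov_product_act; exact: HN.
Qed.

Lemma act_asymptotic_class g (s : nat -> X) :
  [set A g \o t | t in asymptotic_class s] = asymptotic_class (A g \o s).
Proof.
apply/seteqP; split=> [_ [t [ct st] <-]|u [cu su]].
  by split; [exact/asymptotic_act|exact/asymptotic_act].
have uE : A g \o (A g^-1%g \o u) = u by apply/funext => n /=; rewrite hactVK.
exists (A g^-1%g \o u) => //; split.
  by apply/(asymptotic_act g); rewrite uE.
by apply/(asymptotic_act g); rewrite uE.
Qed.

Lemma boundary_act_subproof g (xi : boundary X) :
  exists2 s, converges_at_infinity s &
    [set A g \o t | t in boundary_class xi] = asymptotic_class s.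
Proof.
have [s cs ->] := boundary_classP xi; exists (A g \o s).
  exact/asymptotic_act.
exact: act_asymptotic_class.
Qed.

Definition boundary_act g (xi : boundary X) : boundary X :=
  Boundary (boundary_act_subproof g xi).

Lemma boundary_actK g : cancel (boundary_act g) (boundary_act g^-1%g).
Proof.
move=> xi; apply: boundary_eq => /=; apply/seteqP; split=> [_ [_ [t Ht <-] <-]|t Ht].
  by rewrite (_ : _ \o _ = t)//; apply/funext => n /=; rewrite hactK.
exists (A g \o t); first by exists t.
by apply/funext => n /=; rewrite hactK.
Qed.

Lemma pairs_act_subproof g (e : boundary_pairs X) :
  (boundary_act g (val e).1, boundary_act g (val e).2)
    \in [set q : boundary X * boundary X | q.1 <> q.2].
Proof.
rewrite inE /= => /(can_inj (boundary_actK g)).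
by have := valP e; rewrite inE.
Qed.

Definition pairs_act g (e : boundary_pairs X) : boundary_pairs X :=
  exist (fun q => q \in _) _ (pairs_act_subproof g e).

Lemma boundary2_act_subproof g (e : boundary2 X) : exists xi eta, xi <> eta /\
  [set boundary_act g zeta | zeta in boundary2_set e] = [set xi; eta].
Proof.
have [xi [eta [ne ->]]] := boundary2_setP e.
exists (boundary_act g xi), (boundary_act g eta); split.
  by move=> /(can_inj (boundary_actK g)).
by rewrite image_setU !image_set1.
Qed.

Definition boundary2_act g (e : boundary2 X) : boundary2 X :=
  Boundary2 (boundary2_act_subproof g e).

Definition expgz g (n : int) : G :=
  match n with Posz m => (g ^+ m)%g | Negz m => (g ^- m.+1)%g end.

Definition loxodromic h : Prop := exists x : X,
  qi_embedding (fun m n : int => `|m - n|%:~R) (fun n : int => A (expgz h n) x).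

Definition attracting_fixed_point h (xi : boundary X) : Prop :=
  boundary_act h xi = xi /\
  forall x, boundary_class xi (fun n : nat => A (h ^+ n)%g x).

Definition repelling_fixed_point h (xi : boundary X) : Prop :=
  attracting_fixed_point h^-1%g xi.

Definition same_left_coset (S : set G) g g' : Prop :=
  exists k, [set (k * s)%g | s in S] g /\ [set (k * s)%g | s in S] g'.

Definition orbit (T : Type) (act : G -> T -> T) (u : T) : set T :=
  [set act g u | g in setT].

Definition stab (T : Type) (act : G -> T -> T) (u : T) : set G :=
  [set g | act g u = u].

End HyperbolicActions.

(* Existence of the two fixed points of a loxodromic element. *)
Lemma coarsely_additive (R : realType) (a : nat -> R) (K C d : R) :
  0 < K -> a 0%N = 0 -> (forall n, 0 <= a n) ->
  (forall n, K^-1 * n%:R - C <= a n) ->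
  (forall m n, a (m + n)%N <= a m + a n) ->
  (forall m n, a m <= a (m + n)%N + a n) ->
  (forall p q r, a (p + q)%N + a (q + r)%N <= a p + a r + 2 * d \/
                 a (p + q)%N + a (q + r)%N <= a (p + q + r)%N + a q + 2 * d) ->
  exists B, forall m n, a m + a n - B <= a (m + n)%N.
Proof.
move=> K0 a0 age0 alin asub arev a4.
have d0 : 0 <= d by have := a4 0%N 0%N 0%N; rewrite a0; case; lra.
pose L := 4 * d + 1.
have [N N0 HN] : exists2 N, (0 < N)%N & a N + L <= a (N + N)%N.
  apply: contrapT => /forall2NP H.
  have Hk k : a (2 ^ k)%N <= a 1%N + k%:R * L.
    elim: k => [|k IH]; first by rewrite expn0; lra.
    have [/negP|/negP] := H (2 ^ k)%N; first by rewrite expn_gt0.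
    rewrite -ltNge addnn -mul2n -expnS => /ltW /le_trans; apply.
    by rewrite -natr1; lra.
  pose Q := K * (`|C| + a 1%N + 2 * L) + 1.
  have Q1 : 1 <= Q.
    rewrite lerDr mulr_ge0 ?(ltW K0)//.
    by have := age0 1%N; have := normr_ge0 C; rewrite /L; lra.
  have Q0 : 0 <= Q by lra.
  have := archi_boundP Q0; set m := Num.bound Q => Qm.
  have h1 := Hk (m + m)%N; have h2 := alin (2 ^ (m + m))%N.
  have h3 : (m%:R * m%:R <= (2 ^ (m + m))%:R :> R).
    by rewrite -natrM ler_nat expnD leq_mul // ltnW // ltn_expl.
  have h4 : K^-1 * (m%:R * m%:R) <= K^-1 * (2 ^ (m + m))%:R.
    by rewrite ler_pM2l // invr_gt0.
  have h5 : K^-1 * (m%:R * m%:R) <= `|C| + a 1%N + (m + m)%:R * L.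
    by have := ler_norm C; lra.
  have h6 : m%:R * m%:R <= K * (`|C| + a 1%N + (m + m)%:R * L).
    by rewrite -ler_pdivrMl.
  have m1 : 1 <= m%:R :> R by lra.
  have h7 : `|C| + a 1%N + (m + m)%:R * L <= m%:R * (`|C| + a 1%N + 2 * L).
    rewrite natrD.
    have : 0 <= (m%:R - 1) * (`|C| + a 1%N).
      by apply: mulr_ge0; [rewrite subr_ge0|apply: addr_ge0].
    lra.
  have h8 : m%:R * m%:R <= m%:R * (K * (`|C| + a 1%N + 2 * L)).
    by apply: (le_trans h6); rewrite mulrCA ler_pM2l.
  have : m%:R <= K * (`|C| + a 1%N + 2 * L) by rewrite ler_pM2l ?(lt_le_trans ltr01) // in h8.
  by rewrite /Q in Qm; lra.
pose b k := a (k * N)%N.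
have bE p q r : b (p + q)%N + b (q + r)%N <= b p + b r + 2 * d \/
                b (p + q)%N + b (q + r)%N <= b (p + q + r)%N + b q + 2 * d.
  by rewrite /b !mulnDl; exact: a4.
have b2 : b 1%N + L <= b 2%N by rewrite /b mul1n mul2n -addnn.
have b0 : b 0%N = 0 by rewrite /b mul0n.
have binc k : b k + (2 * d + 1) <= b k.+1.
  elim: k => [|k IH].
    have := asub N N; have : b 1%N = a N by rewrite /b mul1n.
    by move: HN; rewrite /L b0; lra.
  have [] := bE 1%N 1%N k; rewrite !add1n => H; rewrite /L in b2; lra.
have bsup j k : b j + b k - (b 1%N + 2 * d) <= b (j + k)%N.
  case: k => [|k]; first by rewrite addn0 b0; have := age0 (1 * N)%N; rewrite -/(b 1%N); lra.
  have := binc j; have := binc k.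
  have [] := bE j 1%N k; rewrite add1n addn1 ?addSnnS => H; lra.
have ar r : (r < N)%N -> a r <= N%:R * a 1%N.
  move=> rN; apply: (@le_trans _ _ (r%:R * a 1%N)).
    elim: r {rN} => [|r IH]; first by rewrite a0 mul0r.
    by rewrite -addn1 natrD mulrDl mul1r; apply: (le_trans (asub _ _)); rewrite lerD2r.
  by rewrite ler_wpM2r // ler_nat ltnW.
pose E := N%:R * a 1%N.
have aE m : a m <= b (m %/ N)%N + E.
  rewrite {1}(divn_eq m N); apply: (le_trans (asub _ _)).
  by rewrite lerD2l ar // ltn_mod.
exists (b 1%N + 2 * d + 4 * E) => m n.
have := aE m; have := aE n; have := bsup (m %/ N)%N (n %/ N)%N.
have := arev (m %/ N * N + n %/ N * N)%N (m %% N + n %% N)%N.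
rewrite -mulnDl -/(b _).
rewrite (_ : ((m %/ N + n %/ N) * N + (m %% N + n %% N) = m + n)%N); last first.
  by rewrite mulnDl addnACA -!divn_eq.
have := asub (m %% N)%N (n %% N)%N.
have := ar (m %% N)%N; rewrite ltn_mod => /(_ N0).
have := ar (n %% N)%N; rewrite ltn_mod => /(_ N0).
by rewrite -/E; lra.
Qed.

Section Endpoints.
Context {R : realType} {G : groupType} {X : metricType R}.
Variable A : hyperbolic_action G X.
Implicit Types (g h k : G) (x y p : X).

Lemma orbit_dist g x (i n : nat) :
  mdist (A (g ^+ i)%g x) (A (g ^+ (i + n))%g x) = mdist x (A (g ^+ n)%g x).
Proof. by rewrite expgnDr hactM hact_isometry. Qed.

Lemma mdist_invX g x n : mdist x (A (g^-1 ^+ n)%g x) = mdist x (A (g ^+ n)%g x).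
Proof.
by rewrite -(hact_isometry A (g ^+ n)%g) expVgn hactVK metric_sym.
Qed.

Definition orbit_growth g x (B : R) : Prop :=
  (forall M : R, exists N : nat, forall n, (N <= n)%N ->
     M <= mdist x (A (g ^+ n)%g x)) /\
  (forall m n, mdist x (A (g ^+ m)%g x) + mdist x (A (g ^+ n)%g x) - B
                 <= mdist x (A (g ^+ (m + n))%g x)).

Lemma loxodromic_growth h : loxodromic A h -> exists x B, orbit_growth h x B.
Proof.
move=> [x [K [C [K1 C0 H]]]]; exists x.
have K0 : 0 < K by lra.
pose a n := mdist x (A (h ^+ n)%g x).
have lin n : K^-1 * n%:R - C <= a n.
  have /andP[+ _] := H 0%Z n%:Z.
  by rewrite /= expg0 hact1 sub0r normrN ger0_norm.
have [d Hd] := hact_hyperbolic A.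
have [|||||||B HB] := @coarsely_additive R a K C d.
- by [].
- by rewrite /a expg0 hact1 mdistxx.
- by move=> n; exact: mdist_ge0.
- exact: lin.
- move=> m n; rewrite /a -(orbit_dist h x m n); exact: metric_triangle.
- move=> m n; rewrite /a -(orbit_dist h x m n).
  by rewrite [X in _ <= _ + X]metric_sym; exact: metric_triangle.
- move=> p q r.
  have := Hd x (A (h ^+ p)%g x) (A (h ^+ (p + q))%g x) (A (h ^+ (p + q + r))%g x).
  have := orbit_dist h x p (q + r); rewrite addnA /gromov_product => ->.
  rewrite !orbit_dist -/(a p) -/(a q) -/(a r) -/(a (p + q)%N) -/(a (q + r)%N).
  rewrite -/(a (p + q + r)%N) lerBlDr ge_min => /orP[] Hq; [right|left]; lra.
- exists B; split=> [M|m n]; last exact: HB.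
  exists (Num.bound (`|K * (M + C)|)) => n Hn.
  apply: le_trans (lin n); rewrite lerBrDr -ler_pdivrMl ?invr_gt0 // invrK.
  apply: (le_trans (ler_norm _)); apply: ltW.
  by apply: (lt_le_trans (archi_boundP (normr_ge0 _))); rewrite ler_nat.
Qed.

Lemma gromov_product_base (p q y z : X) :
  gromov_product q y z <= gromov_product p y z + mdist p q.
Proof.
have := metric_triangle q p y; have := metric_triangle q p z.
by rewrite /gromov_product (metric_sym q p); lra.
Qed.

Lemma asymptotic_close (s t u : nat -> X) (D : R) :
  asymptotic s t -> (forall n, mdist (t n) (u n) <= D) -> asymptotic s u.
Proof.
move=> /asymptoticP st tu; apply/asymptoticP => p M.
have [N HN] := st p (M + D); exists N => i j Ni Nj.
have := HN i j Ni Nj; have := tu j.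
have := metric_triangle p (u j) (t j); have := metric_triangle (s i) (t j) (u j).
by rewrite /gromov_product (metric_sym (u j) (t j)); lra.
Qed.

Lemma orbit_converges g x B : orbit_growth g x B ->
  converges_at_infinity (fun n => A (g ^+ n)%g x).
Proof.
move=> [H1 H2]; apply/asymptoticP => p M.
have [N HN] := H1 (M + `|B| / 2 + mdist p x).
exists N => i j Ni Nj.
wlog ij : i j Ni Nj / (i <= j)%N.
  by move=> W; have [/W|/ltnW/W] := leqP i j; [|rewrite gromov_productC]; apply.
have := gromov_product_base p x (A (g ^+ i)%g x) (A (g ^+ j)%g x).
have := HN i Ni; have := H2 i (j - i)%N.
have := orbit_dist g x i (j - i)%N; rewrite subnKC // /gromov_product => ->.
by have := ler_norm B; lra.
Qed.

Lemma attracting_exists g x B : orbit_growth g x B ->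
  exists xi, attracting_fixed_point A g xi.
Proof.
move=> gB; have cs := orbit_converges gB.
set s := (fun n : nat => _) in cs.
have P : exists2 s', converges_at_infinity s' &
    asymptotic_class s = asymptotic_class s' by exists s.
exists (Boundary P); split.
  apply: boundary_eq => /=; rewrite act_asymptotic_class.
  apply: asymptotic_class_eq (hact_hyperbolic A) _; apply: asymptotic_sym.
  apply: (asymptotic_close (D := mdist x (A g x)) cs) => n /=.
  by rewrite /s -hactM -expgS expgSr hactM hact_isometry.
move=> y /=.
have sy : asymptotic s (fun n => A (g ^+ n)%g y).
  apply: (asymptotic_close (D := mdist x y) cs) => n.
  by rewrite /s hact_isometry.
split=> //; apply: (asymptotic_close (D := mdist x y) (asymptotic_sym sy)) => n.
by rewrite /s hact_isometry.
Qed.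

Lemma endpoints_exist h : loxodromic A h -> exists e : boundary_pairs X,
  repelling_fixed_point A h (val e).1 /\ attracting_fixed_point A h (val e).2.
Proof.
move=> /loxodromic_growth[x [B hB]].
have hVB : orbit_growth h^-1%g x B.
  case: hB => H1 H2; split=> [M|m n]; last by rewrite !mdist_invX.
  by have [N HN] := H1 M; exists N => n; rewrite mdist_invX; exact: HN.
have [xim Hm] := attracting_exists hVB.
have [xip Hp] := attracting_exists hB.
have ne : (xim, xip) \in [set q : boundary X * boundary X | q.1 <> q.2].
  rewrite inE /= => E; move: (Hm.2 x) (Hp.2 x); rewrite E.
  have [s _ ->] := boundary_classP xip => -[_ su] [_ sv].
  have := asymptotic_trans (hact_hyperbolic A) (asymptotic_sym su) sv.
  move=> /asymptoticP /(_ x (B + 1)) [N HN]; have := HN N N (leqnn _) (leqnn _).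
  rewrite /gromov_product mdist_invX.
  rewrite -(hact_isometry A (h ^+ N)%g (A (h^-1 ^+ N)%g x)).
  rewrite expVgn hactVK -hactM -expgnDr.
  have := hB.2 N N; have := hB.2 0%N 0%N; rewrite expg0 hact1 mdistxx; lra.
by exists (exist (fun q => q \in _) _ ne).
Qed.

(* For loxodromic h, the pair (repelling, attracting) of fixed points; both are
   unique, so the choice is immaterial. *)
Definition endpoints h (lox : loxodromic A h) : boundary_pairs X :=
  sval (cid (endpoints_exist lox)).

Definition repelling_end h (lox : loxodromic A h) : boundary X :=
  (val (endpoints lox)).1.

Definition attracting_end h (lox : loxodromic A h) : boundary X :=
  (val (endpoints lox)).2.

Definition endpoint_set h (lox : loxodromic A h) : boundary2 X :=
  unordered (endpoints lox).

Definition independent g h (loxg : loxodromic A g) (loxh : loxodromic A h) :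
    Prop :=
  boundary2_set (endpoint_set loxg) `&` boundary2_set (endpoint_set loxh)
    = set0.

Definition quasi_axis h (l : R -> X) : Prop :=
  [/\ continuous l, qi_embedding (fun s t : R => `|s - t|) l &
      exists2 T : R, 0 < T & forall t, A h (l t) = l (t + T)].

(* f restricts to a closest point map E -> F; its values off E are irrelevant. *)
Definition closest_point_map (E F : set X) (f : X -> X) : Prop :=
  forall y, E y -> F (f y) /\ forall z, F z -> mdist y (f y) <= mdist y z.

Definition discrete_subset (T : topologicalType) (E : set T) : Prop :=
  E `<=` isolated E.

Section WWPD.
Variables (h : G) (lox : loxodromic A h).

Definition stab_ordered : set G := stab (pairs_act A) (endpoints lox).

Definition stab_unordered : set G := stab (boundary2_act A) (endpoint_set lox).

Definition wwpd_finiteness : Prop :=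
  forall x (r : R), 0 < r -> exists2 M : nat, (1 <= M)%N & forall Z : set G,
    (forall g, Z g -> mdist x (A g x) < r /\
       mdist (A (h ^+ M)%g x) (A (g * h ^+ M)%g x) < r) ->
    (forall g g', Z g -> Z g' -> g <> g' -> ~ same_left_coset stab_ordered g g') ->
    finite_set Z.

Definition wwpd_discrete_unordered : Prop :=
  discrete_subset (orbit (boundary2_act A) (endpoint_set lox)).

Definition wwpd_discrete_ordered : Prop :=
  discrete_subset (orbit (pairs_act A) (endpoints lox)).

Definition wwpd_projection : Prop :=
  forall l, quasi_axis h l -> exists2 D : R, 0 <= D & forall g,
    ~ stab_unordered g ->
    forall f, closest_point_map (A g @` range l) (range l) f ->
      (diameter (f @` (A g @` range l)) <= D%:E)%E.

Definition distinct_left_cosets (g : nat -> G) : Prop :=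
  forall i j, i <> j -> ~ same_left_coset stab_ordered (g i) (g j).

Definition eventually_close (g : nat -> G) x (r : R) : Prop :=
  forall M : nat, exists I : nat, forall m i : nat, (m <= M)%N -> (I <= i)%N ->
    mdist (A (g i * h ^+ m)%g x) (A (h ^+ m)%g x) < r.

Definition wwpd_no_sequence_forall : Prop :=
  ~ exists g : nat -> G, distinct_left_cosets g /\
      forall x, exists2 r : R, 0 < r & eventually_close g x r.

Definition wwpd_no_sequence_exists : Prop :=
  ~ exists g : nat -> G, distinct_left_cosets g /\
      exists x, exists2 r : R, 0 < r & eventually_close g x r.

(* Equivalent to each of the other conditions above. *)
Definition WWPD : Prop := wwpd_finiteness.

End WWPD.

End Endpoints.

(* Main.v *)
Require Import Defs.
From mathcomp Require Import all_boot all_order all_algebra.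
From mathcomp Require Import all_classical all_reals all_analysis.
From mathcomp Require Import ring lra.
Set Implicit Arguments.
Unset Strict Implicit.
Unset Printing Implicit Defensive.
Import Order.TTheory GRing.Theory Num.Theory.
Import numFieldNormedType.Exports.
Local Open Scope classical_set_scope.
Local Open Scope ring_scope.

(** Everything is read off a rough line P through an orbit of h: a map from the
    reals to X with d(P u, P v) = |u - v| up to a constant, such that h^n moves P
    along itself by tau n, where tau is the translation length of h
    ([loxodromic_orbit_line]). Two lines have the same ends if and only if one is a
    bounded distance away from the other after a shift of the parameter, and then
    the bound is uniform ([same_ends_parallel], [bounded_same_ends]); so the
    stabilizers of the endpoints consist of the elements that move P to a line
    parallel to P or to P reversed.

    All conditions are compared with the following rigidity ([rigid_ordered]): for
    every r there is M such that an element moving both P (- M) and P M by at most r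
    fixes the two endpoints of h. By the four-point inequality such an element
    moves the whole segment between these points by a bounded amount.

    - Rigidity gives finiteness, because after conjugation by a power of h the
      quotient of two elements of Z coarsely fixes a long segment centred at the
      base point, so Z has at most one element ([rigid_finiteness]). Finiteness
      excludes the sequences. Conversely, elements violating rigidity on longer and
      longer segments contain such a sequence ([no_sequence_rigid]).
    - Two translates of the pair of endpoints are close in the boundary exactly when
      the two translates of P fellow travel along a long segment; this translates
      discreteness into rigidity and back ([close_rigid], [close_matched]).
    - If the projection of a translate of a quasi-axis to the quasi-axis is large,
      the translate follows the quasi-axis along a long segment, and conversely
      ([rigid_projection], [projection_rigid]).

    Discreteness of unordered pairs and the projections do not see orientations.
    They only give that the element stabilizes the unordered pair, and they also
    have to deal with elements reversing a long segment. An element that fixes a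
    long segment coarsely does not exchange the endpoints
    ([rigid_unordered_ordered]); and two elements reversing the same long segment
    differ by one that coarsely fixes it ([rigid_ordered_flips]).

    For the consequences: an element fixing one endpoint of h coarsely fixes a half
    line of P, and its conjugate by a high power of h coarsely fixes a long segment
    centred at the base point, so it fixes both endpoints ([rigid_half_line]). As a
    loxodromic element fixes no boundary points besides its endpoints
    ([loxodromic_fixed_points]), loxodromic elements sharing an endpoint with h
    share both.

    Numerical factors such as 50 and 200 are generous upper bounds for sums of error
    terms; only their independence of the points, lines and scales matters. *)

(** * Rough geodesic lines in a hyperbolic space *)

Section RoughLines.
Context {R : realType} {X : metricType R}.
Implicit Types (x y z o : X) (p q : R -> X).

(** The parameter is an arbitrary real, so that points at a prescribed distance
    can be chosen without rounding. *)
Definition rough_line (c : R) p : Prop :=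
  forall u v, u <= v -> v - u - c <= mdist (p u) (p v) <= v - u + c.

Definition hyperbolic_with (delta : R) : Prop :=
  0 <= delta /\ forall o x y z,
    Num.min (gromov_product o x y) (gromov_product o y z) - delta
      <= gromov_product o x z.

Lemma hyperbolic_const : gromov_hyperbolic X ->
  inhabited X -> exists delta, hyperbolic_with delta.
Proof.
move=> [d Hd] [x]; exists d; split=> //.
have := Hd x x x x; rewrite minxx /gromov_product mdistxx; lra.
Qed.

Lemma rough_line_ge0 c p : rough_line c p -> 0 <= c.
Proof. by move=> /(_ 0 0 (lexx _)); rewrite mdistxx; lra. Qed.

Lemma rough_line_le c p u v : rough_line c p ->
  mdist (p u) (p v) <= `|u - v| + c.
Proof.
move=> H; have [uv|vu] := leP u v.
  by rewrite ler0_norm ?subr_le0 //; have := H u v uv; lra.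
by rewrite gtr0_norm ?subr_gt0 // metric_sym; have := H v u (ltW vu); lra.
Qed.

Lemma rough_line_ge c p u v : rough_line c p ->
  `|u - v| - c <= mdist (p u) (p v).
Proof.
move=> H; have [uv|vu] := leP u v.
  by rewrite ler0_norm ?subr_le0 //; have := H u v uv; lra.
by rewrite gtr0_norm ?subr_gt0 // metric_sym; have := H v u (ltW vu); lra.
Qed.

Lemma rough_line_rev c p : rough_line c p -> rough_line c (fun u => p (- u)).
Proof.
move=> H u v uv; rewrite metric_sym.
have /H/andP[h1 h2] : - v <= - u by lra.
by apply/andP; split; lra.
Qed.

Lemma rough_line_shift c p t : rough_line c p -> rough_line c (fun u => p (u + t)).
Proof.
move=> H u v uv; have /H/andP[h1 h2] : u + t <= v + t by lra.
by apply/andP; split; lra.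
Qed.

Variable delta : R.
Hypothesis hyp : hyperbolic_with delta.

Lemma four_point x y z w :
  mdist x z + mdist y w <= mdist x y + mdist z w + 2 * delta \/
  mdist x z + mdist y w <= mdist y z + mdist x w + 2 * delta.
Proof.
have := hyp.2 w x y z; rewrite /gromov_product lerBlDr ge_min.
rewrite !(metric_sym w) => /orP[] H; [left|right]; lra.
Qed.

(** If the sum of the distances to p u and p v is almost d(p u, p v), then y is
    close to the point of the line at distance d(p u, y) from p u. *)
Lemma near_between c p u v y (e : R) : rough_line c p -> 0 <= e -> u <= v ->
  mdist (p u) y + mdist y (p v) <= mdist (p u) (p v) + e ->
  exists w, [/\ u <= w, w <= v & mdist y (p w) <= e + 2 * c + 2 * delta].
Proof.
move=> lp e0 uv H; have c0 := rough_line_ge0 lp; have d0 := hyp.1.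
have a0 := mdist_ge0 (p u) y; have uvd := lp _ _ uv.
have [Av|vA] := leP (u + mdist (p u) y) v; last first.
  by exists v; split => //; lra.
exists (u + mdist (p u) y); split; [lra | lra |].
set w := u + _ in Av *.
have uw : u <= w by rewrite /w; lra.
have := lp _ _ uw; have := lp _ _ Av.
have := four_point y (p u) (p w) (p v).
rewrite (metric_sym y (p u)) => -[]; rewrite /w; lra.
Qed.

Lemma near_between_unordered c p u v y (e : R) : rough_line c p -> 0 <= e ->
  mdist (p u) y + mdist y (p v) <= mdist (p u) (p v) + e ->
  exists w, mdist y (p w) <= e + 2 * c + 2 * delta.
Proof.
move=> lp e0 H; have [uv|/ltW vu] := leP u v.
  by have [w [_ _ Hw]] := near_between lp e0 uv H; exists w.
have [|w [_ _ Hw]] := near_between (y := y) lp e0 vu; last by exists w.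
by rewrite (metric_sym (p v) y) (metric_sym y (p u)) (metric_sym (p v)); lra.
Qed.

(** The four-point inequality for p a, p b and the two inner points: the distances
    from the inner points to p a and p b are known up to a constant, because both
    lines run at unit speed. *)
Lemma fellow_travel c p q a b i j (e : R) : rough_line c p -> rough_line c q ->
  a <= b -> i <= j -> mdist (p a) (q i) <= e -> mdist (p b) (q j) <= e ->
  forall m, 0 <= m <= b - a ->
    mdist (p (a + m)) (q (i + m)) <= 5 * c + 3 * e + 2 * delta.
Proof.
move=> lp lq ab ij Ha Hb m /andP[m0 mb]; have c0 := rough_line_ge0 lp; have d0 := hyp.1.
have e0 : 0 <= e by apply: le_trans Ha; exact: mdist_ge0.
have d1 := lp _ _ ab; have d2 := lq _ _ ij.
have t1 := metric_triangle (p a) (q i) (p b).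
have t2 := metric_triangle (q i) (q j) (p b).
have t3 := metric_triangle (q i) (p a) (q j).
have t4 := metric_triangle (p a) (p b) (q j).
rewrite (metric_sym (q j)) (metric_sym (q i) (p a)) in t1 t2 t3 t4.
have m1 : a <= a + m by lra.
have m2 : a + m <= b by lra.
have m3 : i <= i + m by lra.
have h1 := lp _ _ m1; have h2 := lp _ _ m2; have h3 := lq _ _ m3.
have h4 : mdist (q (i + m)) (q j) <= b - a - m + 3 * c + 2 * e.
  have [l|/ltW l] := leP (i + m) j; first by have := lq _ _ l; lra.
  by rewrite metric_sym; have := lq _ _ l; lra.
have t5 := metric_triangle (p a) (q i) (q (i + m)).
have t6 := metric_triangle (q (i + m)) (q j) (p b).
rewrite (metric_sym (q j)) in t6.
have := four_point (p (a + m)) (p a) (q (i + m)) (p b).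
rewrite (metric_sym (p (a + m)) (p a)) => -[]; lra.
Qed.

(** The Gromov product of y and p n at p a is the distance from p a at which the
    paths to y and to p n separate; if it were large, the point of the line at
    that distance from p a would be much closer to y than p a. *)
Lemma projection_between c p y a (e : R) : rough_line c p -> 0 <= e ->
  (forall n, mdist y (p a) <= mdist y (p n) + e) ->
  forall n, mdist y (p a) + mdist (p a) (p n)
              <= mdist y (p n) + (2 * e + 6 * c + 4 * delta).
Proof.
move=> lp e0; wlog an : p lp a / a <= 0.
  move=> W H n; have l' := rough_line_shift (a : R) lp.
  have := W _ l' 0 (lexx 0); rewrite add0r => /(_ _ (n - a)).
  by rewrite subrK; apply => k; exact: H.
move=> H n; have c0 := rough_line_ge0 lp; have d0 := hyp.1.
wlog an' : p lp a an H n / a <= n.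
  move=> W; have [|/ltW na] := leP a n; first exact: W.
  pose p' := fun u => p (- (u - 2 * a)).
  have l' : rough_line c p' := rough_line_shift (- (2 * a)) (rough_line_rev lp).
  have p'a : p' a = p a by congr p; ring.
  have p'n : p' (2 * a - n) = p n by congr p; ring.
  have := W _ l' a an; rewrite p'a => /(_ _ (2 * a - n)); rewrite p'n.
  by apply; [move=> k; exact: H|lra].
pose s := (mdist y (p a) + mdist (p a) (p n) - mdist y (p n)) / 2.
have dn := lp _ _ an'.
have s0 : 0 <= s by have := metric_triangle y (p a) (p n); rewrite /s; lra.
have sn : s <= mdist (p a) (p n).
  by have := metric_triangle y (p n) (p a); rewrite /s (metric_sym (p n)); lra.
have [s' [s'0 s'n s's ss']] : exists s', [/\ 0 <= s', s' <= n - a, s' <= s & s - c <= s'].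
  have [l|l] := leP s (n - a); first by exists s; split=> //; lra.
  by exists (n - a); split => //; lra.
have k1 : a <= a + s' by lra.
have k2 : a + s' <= n by lra.
have := lp _ _ k1; have := lp _ _ k2; have := H (a + s').
have := four_point y (p a) (p (a + s')) (p n).
rewrite /s in s0 sn s's ss' * => -[]; lra.
Qed.

(** Large projections force fellow travelling: when two points of q project to
    points of p that are far apart, q runs along p, in one of the two
    directions, between these projections. *)
Lemma projection_fellow_travel c p q a b i j (e : R) :
  rough_line c p -> rough_line c q -> 0 <= e ->
  (forall n, mdist (q i) (p a) <= mdist (q i) (p n) + e) ->
  (forall n, mdist (q j) (p b) <= mdist (q j) (p n) + e) ->
  2 * e + 7 * c + 5 * delta < b - a ->
  exists s t, (s = 1 \/ s = -1) /\ forall m, 0 <= m <= b - a ->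
    mdist (p (a + m)) (q (s * m + t)) <= 50 * (e + c + delta).
Proof.
move=> lp lq e0 Hi Hj ab; have c0 := rough_line_ge0 lp; have d0 := hyp.1.
have ab' : a <= b by lra.
have d := lp _ _ ab'.
have h1 := projection_between lp e0 Hi b.
have h2 := projection_between lp e0 Hj a.
rewrite (metric_sym (p b) (p a)) in h2.
have t1 := metric_triangle (p a) (p b) (q j).
have t2 := metric_triangle (q i) (p a) (p b).
rewrite (metric_sym (p b) (q j)) in t1.
have h3 : mdist (q i) (p a) + mdist (q j) (p b) + mdist (p a) (p b)
            <= mdist (q i) (q j) + (4 * e + 12 * c + 10 * delta).
  have := four_point (q i) (q j) (p b) (p a).
  rewrite (metric_sym (p b) (p a)) => -[]; lra.
have e1 : 0 <= 4 * e + 12 * c + 10 * delta by lra.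
have [|i' Hi'] := near_between_unordered (u := i) (v := j) (y := p a) lq e1.
  by rewrite (metric_sym (p a) (q j)) in t1 *; lra.
have [|j' Hj'] := near_between_unordered (u := i) (v := j) (y := p b) lq e1.
  by rewrite (metric_sym (p b) (q j)); lra.
have [ij|/ltW ji] := leP i' j'.
  exists 1, i'; split; first by left.
  move=> m /(fellow_travel lp lq ab' ij Hi' Hj'); rewrite mul1r (addrC m) => ?; lra.
exists (-1), i'; split; first by right.
move=> m mab.
have ji' : - i' <= - j' by lra.
have := @fellow_travel _ _ _ a b (- i') (- j') (4 * e + 12 * c + 10 * delta + 2 * c + 2 * delta)
  lp (rough_line_rev lq) ab' ji'.
rewrite !opprK => /(_ Hi' Hj' m mab); rewrite mulN1r opprD opprK (addrC i'); lra.
Qed.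

(** Replacing p N by q N and p (- N) by q (- N) hardly changes the Gromov products
    of these points seen from p M, so p M lies almost between q (- N) and q N and
    is close to some q k. In the same way p (- M) lies almost between q (- N) and
    q k; looking only before k gives both points of q in the right order. *)
Lemma ends_fellow_travel c p q (M N rho : R) : rough_line c p -> rough_line c q ->
  0 <= M <= N -> M + 3 * c + 2 * delta < rho ->
  rho <= gromov_product (p 0) (p N) (q N) ->
  rho <= gromov_product (p 0) (p (- N)) (q (- N)) ->
  exists t, forall m, - M <= m <= M ->
    mdist (p m) (q (m + t)) <= 50 * (c + delta).
Proof.
move=> lp lq /andP[M0 MN] Mrho Hp Hm; have c0 := rough_line_ge0 lp; have d0 := hyp.1.
have [i1 i2 i3] : [/\ - M <= 0, - N <= - M & - M <= M] by split; lra.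
have [i4 i5 i6] : [/\ - N <= M, - N <= N & 0 <= N] by split; lra.
have b1 := gromov_product_base (p M) (p 0) (p N) (q N).
have b2 := gromov_product_base (p M) (p 0) (p (- N)) (q (- N)).
have b3 := gromov_product_base (p (- M)) (p 0) (p (- N)) (q (- N)).
have k1 := lp _ _ M0; have k2 := lp _ _ i1; have k3 := lp _ _ i2.
have k4 := lp _ _ i3; have k5 := lp _ _ i4; have k6 := lp _ _ i5.
have k7 := lp _ _ MN.
rewrite (metric_sym (p M) (p 0)) in b1 b2.
have f1 : gromov_product (p M) (p (- N)) (q N) <= 3 / 2 * c + delta.
  have := hyp.2 (p M) (p (- N)) (q N) (p N); rewrite lerBlDr ge_min.
  rewrite (gromov_productC (p M) (q N)) => /orP[].
    by rewrite {2}/gromov_product (metric_sym (p M) (p (- N))); lra.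
  by rewrite {2}/gromov_product (metric_sym (p M) (p (- N))); lra.
have f2 : gromov_product (p M) (q (- N)) (q N) <= 3 / 2 * c + 2 * delta.
  by have := hyp.2 (p M) (p (- N)) (q (- N)) (q N); rewrite lerBlDr ge_min => /orP[]; lra.
have e1 : 0 <= 3 * c + 4 * delta by lra.
have [|k [Nk kN Hk]] := near_between (y := p M) lq e1 i5.
  by move: f2; rewrite /gromov_product (metric_sym (p M) (q (- N))); lra.
have f3 : gromov_product (p (- M)) (q (- N)) (p M) <= 3 / 2 * c + delta.
  have := hyp.2 (p (- M)) (p (- N)) (q (- N)) (p M); rewrite lerBlDr ge_min => /orP[];
    by rewrite {2}/gromov_product (metric_sym (p (- M)) (p (- N))); lra.
have e2 : 0 <= 13 * c + 14 * delta by lra.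
have [|l [Nl lk Hl]] := near_between (y := p (- M)) lq e2 Nk.
  move: f3; rewrite /gromov_product (metric_sym (p (- M)) (q (- N))).
  have := metric_triangle (p (- M)) (p M) (q k).
  by have := metric_triangle (q (- N)) (q k) (p M); rewrite (metric_sym (q k) (p M)); lra.
exists (l + M) => m /andP[m1 m2].
have Hk' : mdist (p M) (q k) <= 15 * c + 16 * delta by lra.
have Hl' : mdist (p (- M)) (q l) <= 15 * c + 16 * delta by lra.
have /(fellow_travel lp lq i3 lk Hl' Hk') : 0 <= m + M <= M - - M by lra.
rewrite (_ : - M + (m + M) = m); last by ring.
by rewrite (_ : l + (m + M) = m + (l + M)); [lra|ring].
Qed.

(** Fellow travelling on every window, with shifts depending on the window: the
    shifts are bounded, because all of them bring p 0 close to the line q. *)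
Lemma windows_parallel c p q (C : R) : rough_line c q ->
  (forall M, exists t, forall m, - M <= m <= M -> mdist (p m) (q (m + t)) <= C) ->
  exists t, forall m, mdist (p m) (q (m + t)) <= 3 * C + 2 * c.
Proof.
move=> lq H; have [t0 Ht0] := H 0; exists t0 => m; have [t Ht] := H `|m|.
have i0 : - 0 <= (0 : R) <= 0 by rewrite oppr0 lexx.
have h0 := Ht0 0 i0; rewrite add0r in h0.
have h1 : mdist (p 0) (q t) <= C.
  by have := Ht 0; rewrite add0r; apply; rewrite oppr_le0 normr_ge0.
have h2 : mdist (p m) (q (m + t)) <= C by apply: Ht; rewrite -ler_norml.
have := metric_triangle (q t) (p 0) (q t0); rewrite (metric_sym (q t) (p 0)).
have := metric_triangle (p m) (q (m + t)) (q (m + t0)).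
have := rough_line_ge t t0 lq; have := rough_line_le (m + t) (m + t0) lq.
by rewrite (_ : m + t - (m + t0) = t - t0); [lra|ring].
Qed.

(** Here q reversed follows p, while q itself meets p at M and - M. So q M is close
    to q (t - M), and q (- M) is close to q (t + M); adding the two resulting
    bounds eliminates the shift t. *)
Lemma opposite_bound c p q (C r M t : R) : rough_line c q ->
  (forall m, mdist (p m) (q (- m + t)) <= C) ->
  mdist (p M) (q M) <= r -> mdist (p (- M)) (q (- M)) <= r ->
  2 * M <= C + r + c.
Proof.
move=> lq H h1 h2; have h3 := H M; have h4 := H (- M); rewrite opprK in h4.
have := metric_triangle (q M) (p M) (q (- M + t)); rewrite (metric_sym (q M) (p M)).
have := metric_triangle (q (M + t)) (p (- M)) (q (- M)).
rewrite (metric_sym (q (M + t)) (p (- M))).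
have := rough_line_ge M (- M + t) lq; have := rough_line_ge (M + t) (- M) lq.
have := ler_norm (M - (- M + t)); have := ler_norm (M + t - - M); lra.
Qed.

End RoughLines.

(** * The Gromov boundary and its topology *)

Section BoundaryTopology.
Context {R : realType} {X : metricType R}.
Implicit Types (x y z o : X) (s t u : nat -> X) (xi eta zeta : boundary X).

Definition eventually_product_ge o s t (r : R) : Prop :=
  exists N : nat, forall i j, (N <= i)%N -> (N <= j)%N ->
    r <= gromov_product o (s i) (t j).

Lemma asymptotic_product o s t r : asymptotic s t -> eventually_product_ge o s t r.
Proof. by move=> /asymptoticP/(_ o r). Qed.

Lemma asymptotic_of_product o s t :
  (forall r, eventually_product_ge o s t r) -> asymptotic s t.
Proof.
move=> H; apply/asymptoticP => p B; have [N HN] := H (B + mdist p o).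
exists N => i j Ni Nj; have := HN i j Ni Nj.
have := gromov_product_base p o (s i) (t j); lra.
Qed.

Lemma boundary_converges xi s : boundary_class xi s -> converges_at_infinity s.
Proof. by have [t _ ->] := boundary_classP xi; case. Qed.

Lemma asymptotic_limits s t xi eta : gromov_hyperbolic X ->
  boundary_class xi s -> boundary_class eta t -> asymptotic s t <-> xi = eta.
Proof.
move=> hX xs et; split=> [st|E]; last first.
  move: xs et; rewrite E; have [u _ ->] := boundary_classP eta => -[_ us] [_ ut].
  exact: asymptotic_trans hX (asymptotic_sym us) ut.
move: xs et; have [u cu Eu] := boundary_classP xi.
have [v cv Ev] := boundary_classP eta; rewrite Eu Ev => -[_ us] [_ vt].
apply: boundary_eq; rewrite Eu Ev; apply: asymptotic_class_eq => //.
apply: (asymptotic_trans hX us); apply: (asymptotic_trans hX st).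
exact: asymptotic_sym.
Qed.

Lemma boundary_product_ge o xi eta s t r :
  boundary_class xi s -> boundary_class eta t -> eventually_product_ge o s t r ->
  (r%:E <= boundary_product o xi eta)%E.
Proof.
move=> xs et [N HN]; apply: le_ereal_sup_tmp.
exists (limf_einf (fun ij : nat * nat => (gromov_product o (s ij.1) (t ij.2))%:E)
  (filter_prod \oo \oo)); first by exists (s, t).
rewrite limf_einfE; apply: le_ereal_sup_tmp.
pose V := [set n | (N <= n)%N] `*` [set n | (N <= n)%N].
exists (ereal_inf [set (gromov_product o (s ij.1) (t ij.2))%:E | ij in V]).
  exists V => //; exists ([set n | (N <= n)%N], [set n | (N <= n)%N]) => //=.
  by split; exists N.
by apply: le_ereal_inf_tmp => _ [[i j] /= [Ni Nj] <-]; rewrite lee_fin; exact: HN.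
Qed.

Variable delta : R.
Hypothesis hyp : @hyperbolic_with R X delta.

Lemma eventually_product_trans o s t u r :
  eventually_product_ge o s t r -> eventually_product_ge o t u r ->
  eventually_product_ge o s u (r - delta).
Proof.
move=> [N HN] [M HM]; exists (maxn N M) => i j; rewrite !geq_max.
move=> /andP[Ni _] /andP[_ Mj].
have := hyp.2 o (s i) (t (maxn N M)) (u j).
have := HN i (maxn N M) Ni (leq_maxl _ _); have := HM (maxn N M) j (leq_maxr _ _) Mj.
by rewrite lerBlDr ge_min => ? ? /orP[]; lra.
Qed.

(** Replacing the representatives of two boundary points costs delta for each of
    them; the additional 1 is there because a supremum need not be attained. *)
Lemma boundary_product_eventually o xi eta s t r :
  boundary_class xi s -> boundary_class eta t ->
  (r%:E <= boundary_product o xi eta)%E ->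
  eventually_product_ge o s t (r - 1 - 2 * delta).
Proof.
move=> xs et H; have hX : gromov_hyperbolic X by exists delta; exact: hyp.2.
have : ((r - 1)%:E < boundary_product o xi eta)%E.
  by apply: lt_le_trans H; rewrite lte_fin; lra.
move=> /ereal_sup_gt[_ [[s' t'] /= [xs' et'] <-]].
rewrite limf_einfE => /ereal_sup_gt[_ [V [[P Q] /= [[N _ NP] [M _ MQ]] PQV] <-]] Hr.
have st' : eventually_product_ge o s' t' (r - 1).
  exists (maxn N M) => i j; rewrite !geq_max => /andP[Ni _] /andP[_ Mj].
  rewrite -lee_fin; apply: le_trans (ltW Hr) _; apply: ge_ereal_inf.
  exists ((gromov_product o (s' i) (t' j))%:E) => //; exists (i, j) => //.
  by apply: PQV; split; [exact: NP|exact: MQ].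
have ss' : asymptotic s s' by apply/(asymptotic_limits hX xs xs').
have tt' : asymptotic t' t by apply/(asymptotic_limits hX et' et).
have := eventually_product_trans (asymptotic_product o (r - 1) ss') st'.
move=> /eventually_product_trans => /(_ _ (asymptotic_product o (r - 1 - delta) tt')).
by rewrite (_ : r - 1 - delta - delta = r - 1 - 2 * delta) //; ring.
Qed.

Lemma boundary_representative xi : exists s, boundary_class xi s.
Proof. by have [s cs ->] := boundary_classP xi; exists s; split. Qed.

Lemma boundary_product_trans o xi eta zeta r :
  (r%:E <= boundary_product o xi eta)%E -> (r%:E <= boundary_product o eta zeta)%E ->
  ((r - 1 - 3 * delta)%:E <= boundary_product o xi zeta)%E.
Proof.
have [s xs] := boundary_representative xi.
have [t et] := boundary_representative eta.
have [u zu] := boundary_representative zeta.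
move=> /(boundary_product_eventually xs et) st /(boundary_product_eventually et zu) tu.
apply: (boundary_product_ge xs zu); have := eventually_product_trans st tu.
by rewrite (_ : r - 1 - 2 * delta - delta = r - 1 - 3 * delta) //; ring.
Qed.

Lemma boundary_product_base o o' xi eta r :
  ((r + mdist o o' + 1 + 2 * delta)%:E <= boundary_product o' xi eta)%E ->
  (r%:E <= boundary_product o xi eta)%E.
Proof.
have [s xs] := boundary_representative xi.
have [t et] := boundary_representative eta.
move=> /(boundary_product_eventually xs et)[N HN].
apply: (boundary_product_ge xs et); exists N => i j Ni Nj; have := HN i j Ni Nj.
have := gromov_product_base o o' (s i) (t j); lra.
Qed.

Lemma boundary_product_self o xi r : (r%:E <= boundary_product o xi xi)%E.
Proof.
have [s xs] := boundary_representative xi.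
apply: (boundary_product_ge xs xs); apply: asymptotic_product.
exact: boundary_converges xs.
Qed.

(** The points around which some basic neighbourhood stays inside the given one
    form an open set, by the ultrametric inequality for the boundary product. *)
Lemma boundary_nbhs o xi (r : R) :
  nbhs xi [set eta | (r%:E <= boundary_product o xi eta)%E].
Proof.
pose U := [set eta | exists q : R,
  [set zeta | (q%:E <= boundary_product o eta zeta)%E] `<=`
  [set zeta | (r%:E <= boundary_product o xi zeta)%E]].
have oU : open U.
  move=> eta [q Hq] o'.
  exists (q + 1 + 3 * delta + mdist o o' + 1 + 2 * delta) => zeta /= Hz.
  have {}Hz := boundary_product_base Hz; exists (q + 1 + 3 * delta) => theta /= Ht.
  apply: Hq => /=; have := boundary_product_trans Hz Ht.
  by rewrite (_ : q + 1 + 3 * delta - 1 - 3 * delta = q) //; ring.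
apply: (@filterS _ _ _ U).
  by move=> eta [q Hq]; apply: Hq => /=; exact: boundary_product_self.
by apply: open_nbhs_nbhs; split => //; exists r.
Qed.

Lemma nbhs_boundary o xi (V : set (boundary X)) : nbhs xi V ->
  exists r : R, [set eta | (r%:E <= boundary_product o xi eta)%E] `<=` V.
Proof.
rewrite nbhsE => -[U [oU Ux] UV]; have [r Hr] := oU xi Ux o.
by exists r; apply: subset_trans Hr UV.
Qed.

(** For fixed e these sets of pairs f form a neighbourhood basis of e. *)
Definition close_pairs o (r : R) (e f : boundary_pairs X) : Prop :=
  (r%:E <= boundary_product o (val e).1 (val f).1)%E /\
  (r%:E <= boundary_product o (val e).2 (val f).2)%E.

Lemma nbhs_pairs o (e : boundary_pairs X) V : nbhs e V ->
  exists r : R, forall f, close_pairs o r e f -> V f.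
Proof.
rewrite nbhsE => -[W [[B oB <-] We] WV].
have : nbhs (val e) B by apply: open_nbhs_nbhs.
move=> [[P Q] /= [/(nbhs_boundary o) [r Pr] /(nbhs_boundary o) [q Qq]] PQ].
exists (Num.max r q) => f [H1 H2]; apply: WV; apply: PQ; split.
  by apply: Pr => /=; apply: le_trans H1; rewrite lee_fin le_max lexx.
by apply: Qq => /=; apply: le_trans H2; rewrite lee_fin le_max lexx orbT.
Qed.

Lemma open_pairs (U V : set (boundary X)) : open U -> open V ->
  open [set e : boundary_pairs X | U (val e).1 /\ V (val e).2].
Proof.
move=> oU oV; exists (U `*` V) => //.
by rewrite openE => -[a b] [/= Ua Vb]; exists (U, V) => //; split; apply: open_nbhs_nbhs.
Qed.

Lemma close_pairs_nbhs o (r : R) (e : boundary_pairs X) : nbhs e (close_pairs o r e).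
Proof.
have := boundary_nbhs o (val e).1 r; rewrite nbhsE => -[U [oU Ue] HU].
have := boundary_nbhs o (val e).2 r; rewrite nbhsE => -[V [oV Ve] HV].
apply: (@filterS _ _ _ [set f : boundary_pairs X | U (val f).1 /\ V (val f).2]).
  by move=> f [/HU ? /HV ?]; split.
by apply: open_nbhs_nbhs; split => //; exact: open_pairs.
Qed.

Lemma unordered_eq (e f : boundary_pairs X) : unordered e = unordered f ->
  val e = val f \/ val e = ((val f).2, (val f).1).
Proof.
move=> /(congr1 (@boundary2_set _ _)) /= E.
have H1 : [set (val e).1; (val e).2] (val f).1 by rewrite E; left.
have H2 : [set (val e).1; (val e).2] (val f).2 by rewrite E; right.
have ne : (val f).1 <> (val f).2 by have := valP f; rewrite inE.
move: H1 H2 ne => /=; case: (sval e) (sval f) {E} => [a b] [c d] /= [] -> [] -> ne.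
- by case: ne.
- by left.
- by right.
- by case: ne.
Qed.

Lemma nbhs_pairs2 o (e : boundary_pairs X) V : nbhs (unordered e) V ->
  exists r : R, forall f, close_pairs o r e f -> V (unordered f).
Proof.
rewrite nbhsE => -[W [oW We] WV].
have : nbhs e (@unordered R X @^-1` W) by apply: open_nbhs_nbhs.
move=> /(nbhs_pairs o)[r Hr]; exists r => f /Hr; exact: WV.
Qed.

(** The preimage of such a neighbourhood under [unordered] is a product set
    together with its image under the exchange of coordinates. *)
Lemma close_pairs_nbhs2 o (r : R) (e : boundary_pairs X) :
  nbhs (unordered e) [set unordered f | f in close_pairs o r e].
Proof.
have := boundary_nbhs o (val e).1 r; rewrite nbhsE => -[U [oU Ue] HU].
have := boundary_nbhs o (val e).2 r; rewrite nbhsE => -[V [oV Ve] HV].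
pose W := [set f : boundary_pairs X | U (val f).1 /\ V (val f).2].
apply: (@filterS _ _ _ [set unordered f | f in W]).
  by move=> _ [f [/HU ? /HV ?] <-]; exists f.
apply: open_nbhs_nbhs; split; last by exists e.
rewrite /open /= /boundary2_open.
rewrite (_ : _ @^-1` _ = W `|` [set f : boundary_pairs X | V (val f).1 /\ U (val f).2]).
  by apply: openU; exact: open_pairs.
apply/seteqP; split=> [f /= [f' [Uf Vf] /unordered_eq[] E]|f /= []].
- by left; rewrite /W /= -E.
- by right; move: Uf Vf; rewrite E.
- by move=> Wf; exists f.
move=> [Vf Uf].
have ne : ((val f).2, (val f).1) \in [set q : boundary X * boundary X | q.1 <> q.2].
  by rewrite inE /=; have := valP f; rewrite inE => ? /esym.
exists (exist (fun q => q \in _) _ ne) => //.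
by apply: boundary2_eq => /=; rewrite setUC.
Qed.

End BoundaryTopology.

(** * Ends of rough lines *)

Section Ends.
Context {R : realType} {X : metricType R}.
Implicit Types (x y z o : X) (p q : R -> X) (a b : boundary X).
Variables (delta tau : R).
Hypothesis hyp : @hyperbolic_with R X delta.
Hypothesis tau_gt0 : 0 < tau.

Let hX : gromov_hyperbolic X. Proof. by exists delta; exact: hyp.2. Qed.

(** The step tau makes these rays literally equal to the orbit sequences
    h^n x when p is the line interpolating an orbit. *)
Definition ray p : nat -> X := fun n => p (tau * n%:R).

Definition has_ends p a b : Prop :=
  boundary_class a (ray (fun u => p (- u))) /\ boundary_class b (ray p).

Lemma has_ends_rev p a b : has_ends p a b -> has_ends (fun u => p (- u)) b a.
Proof.
move=> [pa pb]; split => //.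
by move: pb; congr (boundary_class _ _); apply/funext => n; rewrite /ray opprK.
Qed.

Lemma ray_far (r : R) : exists N : nat, forall i, (N <= i)%N -> r <= tau * i%:R.
Proof.
exists (Num.bound (`|r / tau|)) => i Ni.
rewrite mulrC -ler_pdivrMr //; apply: (le_trans (ler_norm _)); apply: ltW.
by apply: (lt_le_trans (archi_boundP (normr_ge0 _))); rewrite ler_nat.
Qed.

Lemma rough_line_product c p u v : rough_line c p -> 0 <= u -> 0 <= v ->
  Num.min u v - 3 / 2 * c <= gromov_product (p 0) (p u) (p v).
Proof.
move=> lp; wlog uv : u v / u <= v.
  move=> W u0 v0; have [uv|vu] := orP (le_total u v); first exact: W.
  by rewrite gromov_productC minC; apply: W.
move=> u0 v0; rewrite min_l //; have := lp _ _ u0; have := lp _ _ v0.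
have := lp _ _ uv; rewrite /gromov_product; lra.
Qed.

Lemma ray_converges c p : rough_line c p -> converges_at_infinity (ray p).
Proof.
move=> lp; apply: (@asymptotic_of_product _ _ (p 0)) => r.
have [N HN] := ray_far (`|r| + 3 / 2 * c); exists N => i j Ni Nj.
have c0 := rough_line_ge0 lp; have r0 := normr_ge0 r.
have hi := HN _ Ni; have hj := HN _ Nj; have hr := ler_norm r.
have i0 : 0 <= tau * i%:R by lra.
have j0 : 0 <= tau * j%:R by lra.
apply: le_trans (rough_line_product lp i0 j0).
by rewrite lerBrDr le_min; apply/andP; split; lra.
Qed.

Lemma bounded_same_ends c p q a b a' b' (C t : R) :
  rough_line c p -> rough_line c q -> has_ends p a b -> has_ends q a' b' ->
  (forall m, mdist (p m) (q (m + t)) <= C) -> a = a' /\ b = b'.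
Proof.
move=> lp lq [pa pb] [qa qb] H.
have H' m : mdist (p m) (q m) <= C + `|t| + c.
  have := metric_triangle (p m) (q (m + t)) (q m); have := H m.
  by have := rough_line_le (m + t) m lq; rewrite [m + t]addrC addrK; lra.
split; [apply/(asymptotic_limits hX pa qa)|apply/(asymptotic_limits hX pb qb)].
  by apply: asymptotic_close (ray_converges (rough_line_rev lp)) _ => n; exact: H'.
by apply: asymptotic_close (ray_converges lp) _ => n; exact: H'.
Qed.

Lemma close_ends_fellow_travel c p q a b a' b' (M r : R) :
  rough_line c p -> rough_line c q -> has_ends p a b -> has_ends q a' b' ->
  0 <= M -> M + 3 * c + 4 * delta + 1 < r ->
  (r%:E <= boundary_product (p 0%R) a a')%E ->
  (r%:E <= boundary_product (p 0%R) b b')%E ->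
  exists t, forall m, - M <= m <= M ->
    mdist (p m) (q (m + t)) <= 50 * (c + delta).
Proof.
move=> lp lq [pa pb] [qa qb] M0 Mr.
move=> /(boundary_product_eventually hyp pa qa)[N1 H1].
move=> /(boundary_product_eventually hyp pb qb)[N2 H2].
have [N3 H3] := ray_far M.
pose N := maxn N1 (maxn N2 N3).
have [n1 n2 n3] : [/\ (N1 <= N)%N, (N2 <= N)%N & (N3 <= N)%N].
  by rewrite /N !leq_max !leqnn !orbT.
apply: (ends_fellow_travel hyp (N := tau * N%:R) lp lq) (H2 N N n2 n2) (H1 N N n1 n1).
  by rewrite M0 H3.
by lra.
Qed.

(** The boundary product of a point with itself is infinite, so the lines fellow
    travel on windows of every size. *)
Lemma same_ends_parallel c p q a b :
  rough_line c p -> rough_line c q -> has_ends p a b -> has_ends q a b ->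
  exists t, forall m, mdist (p m) (q (m + t)) <= 200 * (c + delta).
Proof.
move=> lp lq pab qab.
have [|t Ht] := @windows_parallel R X c p q (50 * (c + delta)) lq.
  move=> M; have MM := ler_norm M; have c0 := rough_line_ge0 lp.
  have [|||t Ht] := @close_ends_fellow_travel c p q a b a b `|M|
    (`|M| + 3 * c + 4 * delta + 2) lp lq pab qab (normr_ge0 _).
  - by lra.
  - exact: boundary_product_self.
  - exact: boundary_product_self.
  - by exists t => m mM; apply: Ht; apply/andP; split; lra.
exists t => m; apply: le_trans (Ht m) _.
by have := rough_line_ge0 lp; have := hyp.1; lra.
Qed.

Lemma match_product c p q (M r : R) : rough_line c p -> rough_line c q ->
  0 <= M -> mdist (p M) (q M) <= r -> mdist (p 0) (q 0) <= r ->
  eventually_product_ge (p 0) (ray p) (ray q) (M - 2 * c - 2 * r - 2 * delta).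
Proof.
move=> lp lq M0 HM H0; have c0 := rough_line_ge0 lp.
have r0 : 0 <= r by apply: le_trans H0; exact: mdist_ge0.
have [N HN] := ray_far M; exists N => i j /HN Mi /HN Mj; rewrite /ray.
have i0 := le_trans M0 Mi; have j0 := le_trans M0 Mj.
have h1 := rough_line_product lp i0 M0; have h2 := rough_line_product lq M0 j0.
rewrite min_r // in h1; rewrite min_l // in h2.
have d0 := hyp.1.
have h3 := gromov_product_base (p 0) (q 0) (q M) (q (tau * j%:R)).
have h4 : M - c - r <= gromov_product (p 0) (p M) (q M).
  have := lp _ _ M0; have := metric_triangle (p 0) (q M) (p M).
  by rewrite /gromov_product (metric_sym (q M)); lra.
have := hyp.2 (p 0) (p (tau * i%:R)) (p M) (q (tau * j%:R)).
have := hyp.2 (p 0) (p M) (q M) (q (tau * j%:R)).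
by rewrite !lerBlDr !ge_min => /orP[] h5 /orP[] h6; lra.
Qed.

(** A point p m with m >= 0 lies almost between q 0 and a far point of q, so it is
    close to some q w. Since both lines run at unit speed, w is m up to a bounded
    error and no shift is needed; C depends on the distance from p 0 to q 0. *)
Lemma same_end_bounded c p q : rough_line c p -> rough_line c q ->
  asymptotic (ray p) (ray q) ->
  exists C, forall m, 0 <= m -> mdist (p m) (q m) <= C.
Proof.
move=> lp lq H; have c0 := rough_line_ge0 lp; have d0 := hyp.1.
pose e := mdist (p 0) (q 0); have e0 : 0 <= e := mdist_ge0 _ _.
exists (2 * (3 * c + 2 * delta + 2 * e + 2 * c + 2 * delta) + 3 * c + e) => m m0.
have [N1 H1] := asymptotic_product (p m) (3 * c + 3 * delta + 1) H.
have [N2 H2] := ray_far m; pose n := maxn N1 N2.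
have {}H1 := H1 n n (leq_maxl _ _) (leq_maxl _ _).
have {}H2 := H2 n (leq_maxr _ _); rewrite /ray in H1; set v := tau * _ in H1 H2.
have v0 : 0 <= v by lra.
have f1 : gromov_product (p m) (p 0) (q v) <= 3 / 2 * c + delta.
  have := hyp.2 (p m) (p 0) (q v) (p v); rewrite lerBlDr ge_min.
  rewrite (gromov_productC _ (q v)) => /orP[]; rewrite {2}/gromov_product;
  have := lp _ _ m0; have := lp _ _ H2; have := lp _ _ v0;
  by rewrite (metric_sym (p m) (p 0)); lra.
have e1 : 0 <= 3 * c + 2 * delta + 2 * e by lra.
have [|w [w0 wv Hw]] := near_between hyp (y := p m) lq e1 v0.
  move: f1; rewrite /gromov_product (metric_sym (p m) (p 0)).
  have := metric_triangle (q 0) (p 0) (p m); have := metric_triangle (p 0) (q 0) (q v).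
  by rewrite (metric_sym (q 0) (p 0)) -/e; lra.
have hm := lp _ _ m0; have hw := lq _ _ w0.
have t1 := metric_triangle (p 0) (p m) (q w); have t2 := metric_triangle (q 0) (p 0) (q w).
have t3 := metric_triangle (p 0) (q 0) (p m); have t4 := metric_triangle (q 0) (q w) (p m).
rewrite (metric_sym (q 0) (p 0)) -/e (metric_sym (q w)) in t2 t3 t4.
have t5 := metric_triangle (p m) (q w) (q m).
have [mw|/ltW wm] := leP m w.
  by have := lq _ _ mw; rewrite (metric_sym (q m)); lra.
by have := lq _ _ wm; lra.
Qed.

End Ends.

(** * The line through an orbit of a loxodromic isometry *)

(** Fekete's argument: all quotients (a n - B) / n lie below all quotients
    a m / m, and tau is chosen between the two families. *)
Lemma coarse_slope (R : realType) (a : nat -> R) (B : R) :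
  (forall n, 0 <= a n) -> (forall m n, a (m + n)%N <= a m + a n) ->
  (forall m n, a m + a n - B <= a (m + n)%N) -> (exists N, B < a N) ->
  exists2 tau : R, 0 < tau & forall n, tau * n%:R <= a n <= tau * n%:R + B.
Proof.
move=> a0 asub asup [N HN].
have aB : a 0%N <= B by have := asup 0%N 0%N; rewrite addn0; lra.
have B0 : 0 <= B by have := a0 0%N; lra.
have scale_le m n : m%:R * (a n - B) <= a (n * m)%N.
  elim: m => [|m IH]; first by rewrite mul0r a0.
  by rewrite mulnS -natr1; have := asup n (n * m)%N; lra.
have scale_ge m n : (0 < m)%N -> a (n * m)%N <= m%:R * a n.
  case: m => // m _; elim: m => [|m IH]; first by rewrite muln1 mul1r.
  by rewrite mulnS -natr1; have := asub n (n * m.+1)%N; lra.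
have cmp m n : (0 < m)%N -> (0 < n)%N -> (a n - B) / n%:R <= a m / m%:R.
  move=> m0 n0; rewrite ler_pdivrMr ?ltr0n // mulrAC ler_pdivlMr ?ltr0n //.
  rewrite mulrC [leRHS]mulrC; apply: le_trans (scale_le m n) _.
  by rewrite mulnC; exact: scale_ge.
have N0 : (0 < N)%N by case: N HN => //; rewrite ltNge aB.
pose S := [set (a n - B) / n%:R | n in [set n | (0 < n)%N]].
have hS : has_sup S.
  by split; [exists ((a N - B) / N%:R), N|exists (a N / N%:R) => _ [n /= n0 <-]; exact: cmp].
exists (reals.sup S).
  apply: (@lt_le_trans _ _ ((a N - B) / N%:R)).
    by rewrite divr_gt0 ?ltr0n // subr_gt0.
  by apply: sup_upper_bound => //; exists N.
case=> [|n]; first by rewrite mulr0 add0r a0.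
apply/andP; split.
  rewrite -ler_pdivlMr ?ltr0n //; apply: (ge_sup hS.1) => _ [k /= k0 <-].
  exact: cmp.
rewrite -lerBlDr -ler_pdivrMr ?ltr0n //.
by apply: sup_upper_bound => //; exists n.+1.
Qed.

Section OrbitLine.
Context {R : realType} {G : groupType} {X : metricType R}.
Variable A : hyperbolic_action G X.
Implicit Types (g h k : G) (x y : X).

Lemma expgz1D h (n : int) : expgz h (n + 1) = (expgz h n * h)%g.
Proof.
case: n => [n|[|n]]; first by rewrite -(PoszD n 1) addn1 /= expgSr.
  by rewrite (_ : Negz 0 + 1 = 0) //= expg1 mulVg.
rewrite (_ : Negz n.+1 + 1 = Negz n); last by rewrite !NegzE -[n.+2]addn1 PoszD opprD subrK.
by rewrite /= (expgS h n.+1) invgM mulgVK.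
Qed.

Lemma expgzB1 h (n : int) : expgz h (n - 1) = (expgz h n * h^-1)%g.
Proof. by rewrite -{2}(subrK 1 n) expgz1D mulgK. Qed.

Lemma expgzD h (m n : int) : expgz h (m + n) = (expgz h m * expgz h n)%g.
Proof.
elim/int_rect: n => [|n IH|n IH]; first by rewrite addr0 /= mulg1.
  by rewrite -[n.+1]addn1 PoszD addrA !expgz1D IH mulgA.
by rewrite -[n.+1]addn1 PoszD opprD addrA !expgzB1 IH mulgA.
Qed.

Lemma expgzN h (n : int) : expgz h (- n) = (expgz h n)^-1%g.
Proof.
by apply/esym/mulg1_eq; rewrite -expgzD subrr.
Qed.

(** When tau is the translation length of h, this line has unit speed up to a
    bounded error; a power h^n moves it along itself by exactly tau n. *)
Definition orbit_line h x (tau : R) : R -> X :=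
  fun u => A (expgz h (Num.floor (u / tau))) x.

Section Step.
Variables (h : G) (x : X) (tau : R).
Hypothesis tau_gt0 : 0 < tau.

Lemma orbit_line_act (n : int) (u : R) :
  A (expgz h n) (orbit_line h x tau u) = orbit_line h x tau (u + tau * n%:~R).
Proof.
rewrite /orbit_line -hactM -expgzD; congr (A (expgz h _) x).
rewrite mulrDl [tau * _]mulrC mulfK ?gt_eqF // floorDrz ?intr_int //.
by rewrite intrKfloor addrC.
Qed.

Lemma orbit_line0 : orbit_line h x tau 0 = x.
Proof. by rewrite /orbit_line mul0r floor0 hact1. Qed.

Lemma orbit_line_nat (n : nat) : orbit_line h x tau (tau * n%:R) = A (h ^+ n)%g x.
Proof. by rewrite -[LHS](congr1 _ (add0r _)) -(orbit_line_act n) orbit_line0. Qed.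

Lemma orbit_line_natN (n : nat) :
  orbit_line h x tau (- (tau * n%:R)) = A (h^-1 ^+ n)%g x.
Proof.
rewrite -mulrN -[LHS](congr1 _ (add0r _)) -[- n%:R](rmorphN intr n%:Z).
by rewrite -orbit_line_act orbit_line0 expgzN /= expVgn.
Qed.

End Step.

(** By hyperbolicity the displacement of x under h^n is coarsely additive in n, so
    it is tau n up to a bounded error. *)
Lemma loxodromic_orbit_line h : loxodromic A h ->
  exists x tau c, 0 < tau /\ rough_line c (orbit_line h x tau).
Proof.
move=> /loxodromic_growth[x [B [far add]]].
have [||||tau tau0 H] := @coarse_slope R (fun n => mdist x (A (h ^+ n)%g x)) B.
- by move=> n; exact: mdist_ge0.
- by move=> m n; rewrite -(orbit_dist A h x m n); exact: metric_triangle.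
- exact: add.
- by have [N HN] := far (B + 1); exists N; have := HN N (leqnn _); lra.
exists x, tau, (B + tau); split=> // u v uv.
rewrite /orbit_line; set k := Num.floor (u / tau); set l := Num.floor (v / tau).
have kl : k <= l by apply: le_floor; rewrite ler_pM2r ?invr_gt0.
have [n ln] : exists n : nat, l = k + n%:Z.
  by exists `|l - k|%N; rewrite gez0_abs ?subr_ge0 // [k + _]addrC subrK.
rewrite ln expgzD hactM hact_isometry.
have := H n; have := floor_itv (u / tau); have := floor_itv (v / tau).
rewrite -/k -/l ln !intrD !ler_pdivlMr // !ltr_pdivrMr //= -[n%:~R]/(n%:R : R).
move=> /andP[v1 v2] /andP[u1 u2] /andP[d1 d2]; apply/andP; split; lra.
Qed.

End OrbitLine.

(** * Stabilizers of the endpoints *)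

Section GroupActions.
Context {G : groupType} {T : Type} (act : G -> T -> T).
Hypothesis act1 : forall u, act 1%g u = u.
Hypothesis actM : forall g k u, act (g * k)%g u = act g (act k u).

Lemma stabM u g k : stab act u g -> stab act u k -> stab act u (g * k)%g.
Proof. by rewrite /stab /= actM => gu ->. Qed.

Lemma stabV u g : stab act u g -> stab act u g^-1%g.
Proof. by rewrite /stab /= => gu; rewrite -{1}gu -actM mulVg act1. Qed.

Lemma stab_expgz u g (n : int) : stab act u g -> stab act u (expgz g n).
Proof.
have nat k g' : stab act u g' -> stab act u (g' ^+ k)%g.
  move=> gu; elim: k => [|k IH]; first by rewrite /stab /= expg0 act1.
  by rewrite expgS; exact: stabM.
by move=> gu; case: n => n /=; [|apply: stabV]; exact: nat.
Qed.

Lemma stab_sandwich u g k (m n : int) : stab act u k ->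
  stab act u (expgz k m * g * expgz k n)%g -> stab act u g.
Proof.
move=> ku H.
have -> : g = ((expgz k m)^-1 * (expgz k m * g * expgz k n) * (expgz k n)^-1)%g.
  by rewrite !mulgA mulVg mul1g mulgK.
by apply: stabM; [apply: stabM => //|]; apply: stabV; exact: stab_expgz.
Qed.

Lemma stab_act_eq u g k : stab act u (g^-1 * k)%g <-> act g u = act k u.
Proof.
rewrite /stab /= actM; split=> [E|<-]; last by rewrite -actM mulVg act1.
by rewrite -[in LHS]E -actM mulgV act1.
Qed.

Lemma same_left_cosetP u g k :
  same_left_coset (stab act u) g k <-> stab act u (g^-1 * k)%g.
Proof.
split=> [[l [[s su <-] [t tu <-]]]|H].
  by rewrite invgM !mulgA mulgVK; apply: stabM => //; exact: stabV.
exists g; split; first by exists 1%g; rewrite ?mulg1 /stab /= ?act1.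
by exists (g^-1 * k)%g; rewrite ?mulgA ?mulgV ?mul1g.
Qed.

End GroupActions.

Section BoundaryActions.
Context {R : realType} {G : groupType} {X : metricType R}.
Variable A : hyperbolic_action G X.
Implicit Types (g h k : G) (a b : boundary X) (e : boundary_pairs X).

Lemma boundary_actM g k a :
  boundary_act A (g * k)%g a = boundary_act A g (boundary_act A k a).
Proof.
apply: boundary_eq => /=; rewrite image_comp; congr image.
by apply/funext => s; apply/funext => n /=; rewrite hactM.
Qed.

Lemma boundary_act1 a : boundary_act A 1%g a = a.
Proof.
apply: boundary_eq => /=; rewrite -[RHS]image_id; congr image.
by apply/funext => s; apply/funext => n /=; rewrite hact1.
Qed.

Lemma pairs_act1 e : pairs_act A 1%g e = e.
Proof. by apply: val_inj => /=; rewrite !boundary_act1; case: (sval e). Qed.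

Lemma pairs_actM g k e : pairs_act A (g * k)%g e = pairs_act A g (pairs_act A k e).
Proof. by apply: val_inj => /=; rewrite !boundary_actM. Qed.

Lemma boundary2_act1 (e : boundary2 X) : boundary2_act A 1%g e = e.
Proof.
apply: boundary2_eq => /=; rewrite -[RHS]image_id; congr image.
by apply/funext => a; rewrite boundary_act1.
Qed.

Lemma boundary2_actM g k (e : boundary2 X) :
  boundary2_act A (g * k)%g e = boundary2_act A g (boundary2_act A k e).
Proof.
apply: boundary2_eq => /=; rewrite image_comp; congr image.
by apply/funext => a /=; rewrite boundary_actM.
Qed.

Lemma boundary2_act_unordered g e :
  boundary2_act A g (unordered e) = unordered (pairs_act A g e).
Proof. by apply: boundary2_eq => /=; rewrite image_setU !image_set1. Qed.

Lemma boundary_class_act g a (s : nat -> X) :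
  boundary_class a s -> boundary_class (boundary_act A g a) (A g \o s).
Proof. by move=> aS; exists s. Qed.

Variables (h : G) (lox : loxodromic A h).

Lemma endpointsP :
  repelling_fixed_point A h (repelling_end lox) /\
  attracting_fixed_point A h (attracting_end lox).
Proof. exact: (svalP (cid (endpoints_exist lox))). Qed.

Lemma endpoints_pair : val (endpoints lox) = (repelling_end lox, attracting_end lox).
Proof. by rewrite /repelling_end /attracting_end; case: (val _). Qed.

Lemma stab_orderedP g : stab_ordered lox g <->
  boundary_act A g (repelling_end lox) = repelling_end lox /\
  boundary_act A g (attracting_end lox) = attracting_end lox.
Proof.
split=> [/(congr1 val) /= E|[E1 E2]].
  by move: E; rewrite [in RHS]endpoints_pair => -[].
by apply: val_inj; rewrite [in RHS]endpoints_pair -[in RHS]E1 -[in RHS]E2.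
Qed.

Lemma ends_neq : repelling_end lox <> attracting_end lox.
Proof. by have := valP (endpoints lox); rewrite inE. Qed.

Definition swaps_ends g : Prop :=
  boundary_act A g (repelling_end lox) = attracting_end lox /\
  boundary_act A g (attracting_end lox) = repelling_end lox.

Lemma stab_unorderedP g :
  stab_unordered lox g <-> stab_ordered lox g \/ swaps_ends g.
Proof.
rewrite /stab_unordered /stab /= /endpoint_set boundary2_act_unordered.
split=> [/unordered_eq[] E|[->//|[E1 E2]]].
- by left; apply: val_inj.
- by right; move: E; rewrite [in RHS]endpoints_pair => -[].
apply: boundary2_eq => /=; rewrite -/(repelling_end lox) -/(attracting_end lox).
by rewrite E1 E2 setUC.
Qed.

Lemma stab_ordered_self : stab_ordered lox h.
Proof.
apply/stab_orderedP; have [[E _] [E' _]] := endpointsP; split => //.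
by rewrite -{1}E -boundary_actM mulgV boundary_act1.
Qed.

Lemma stab_ordered_sub g : stab_ordered lox g -> stab_unordered lox g.
Proof. by move=> H; apply/stab_unorderedP; left. Qed.

Lemma stab_ordered_sandwich g (m n : int) :
  stab_ordered lox (expgz h m * g * expgz h n)%g -> stab_ordered lox g.
Proof. exact: (stab_sandwich pairs_act1 pairs_actM stab_ordered_self). Qed.

Lemma stab_unordered_sandwich g (m n : int) :
  stab_unordered lox (expgz h m * g * expgz h n)%g -> stab_unordered lox g.
Proof.
apply: (stab_sandwich boundary2_act1 boundary2_actM).
exact: stab_ordered_sub stab_ordered_self.
Qed.

Variables (x : X) (tau c delta : R).
Hypothesis hyp : @hyperbolic_with R X delta.
Hypothesis tau_gt0 : 0 < tau.
Local Notation P := (orbit_line A h x tau).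
Hypothesis lineP : rough_line c P.

Lemma rough_line_act g (p : R -> X) :
  rough_line c p -> rough_line c (fun u => A g (p u)).
Proof. by move=> lp u v /lp; rewrite hact_isometry. Qed.

Lemma mdist_conj g (n : int) u :
  mdist (P u) (A (expgz h (- n) * g * expgz h n)%g (P u)) =
  mdist (P (u + tau * n%:~R)) (A g (P (u + tau * n%:~R))).
Proof.
rewrite -orbit_line_act // -(hact_isometry A (expgz h n)).
by rewrite expgzN -hactM -mulgA mulVKg hactM.
Qed.

Lemma has_ends_orbit : has_ends tau P (repelling_end lox) (attracting_end lox).
Proof.
have [[_ Hm] [_ Hp]] := endpointsP; split.
  by move: (Hm x); congr (boundary_class _ _); apply/funext => n; rewrite /ray orbit_line_natN.
by move: (Hp x); congr (boundary_class _ _); apply/funext => n; rewrite /ray orbit_line_nat.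
Qed.

Lemma has_ends_act g (p : R -> X) a b : has_ends tau p a b ->
  has_ends tau (fun u => A g (p u)) (boundary_act A g a) (boundary_act A g b).
Proof. by move=> [pa pb]; split; exact: boundary_class_act. Qed.

(** By the results on ends of lines, stabilizing the pair of endpoints means moving
    the orbit line to a line parallel to it, with a uniform constant. *)
Lemma bounded_ordered g (t C : R) :
  (forall m, mdist (P m) (A g (P (m + t))) <= C) -> stab_ordered lox g.
Proof.
move=> H; apply/stab_orderedP.
have [] := bounded_same_ends hyp tau_gt0 lineP (rough_line_act g lineP)
  has_ends_orbit (has_ends_act g has_ends_orbit) H.
by move=> <- <-.
Qed.

Lemma ordered_bounded g : stab_ordered lox g ->
  exists t, forall m, mdist (P m) (A g (P (m + t))) <= 200 * (c + delta).
Proof.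
move=> /stab_orderedP[E1 E2].
apply: (same_ends_parallel hyp tau_gt0 lineP (rough_line_act g lineP) has_ends_orbit).
by have := has_ends_act g has_ends_orbit; rewrite E1 E2.
Qed.

Lemma has_ends_flip g : has_ends tau (fun u => A g (P (- u)))
  (boundary_act A g (attracting_end lox)) (boundary_act A g (repelling_end lox)).
Proof. exact: (has_ends_act g (has_ends_rev has_ends_orbit)). Qed.

Lemma rough_line_flip g : rough_line c (fun u => A g (P (- u))).
Proof. exact: (rough_line_act g (rough_line_rev lineP)). Qed.

Lemma bounded_swaps g (t C : R) :
  (forall m, mdist (P m) (A g (P (- (m + t)))) <= C) -> swaps_ends g.
Proof.
move=> H; have [] := bounded_same_ends hyp tau_gt0 lineP (rough_line_flip g)
  has_ends_orbit (has_ends_flip g) H.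
by move=> E1 E2; split.
Qed.

Lemma swaps_bounded g : swaps_ends g ->
  exists t, forall m, mdist (P m) (A g (P (- (m + t)))) <= 200 * (c + delta).
Proof.
move=> [E1 E2].
apply: (same_ends_parallel hyp tau_gt0 lineP (rough_line_flip g) has_ends_orbit).
by have := has_ends_flip g; rewrite E1 E2.
Qed.

End BoundaryActions.

(** * Rigidity of coarse matchings *)

Section Rigidity.
Context {R : realType} {G : groupType} {X : metricType R}.
Variable A : hyperbolic_action G X.
Variables (h : G) (lox : loxodromic A h).
Variables (x : X) (tau c delta : R).
Hypothesis hyp : @hyperbolic_with R X delta.
Hypothesis tau_gt0 : 0 < tau.
Local Notation P := (orbit_line A h x tau).
Hypothesis lineP : rough_line c P.

Let c_ge0 : 0 <= c. Proof. exact: rough_line_ge0 lineP. Qed.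
Let delta_ge0 : 0 <= delta. Proof. exact: hyp.1. Qed.

Definition matched g (M r : R) : Prop :=
  mdist (P (- M)) (A g (P (- M))) <= r /\ mdist (P M) (A g (P M)) <= r.

Definition flip_matched g (M r : R) : Prop :=
  mdist (P (- M)) (A g (P M)) <= r /\ mdist (P M) (A g (P (- M))) <= r.

Definition rigid_unordered : Prop := forall r : R, exists2 M : R, 0 <= M &
  forall g, matched g M r -> stab_unordered lox g.

(** An element that coarsely fixes two points of the line that are far apart
    fixes the endpoints; all characterizations are compared with this one. *)
Definition rigid_ordered : Prop := forall r : R, exists2 M : R, 0 <= M &
  forall g, matched g M r -> stab_ordered lox g.

Definition rigid_flips : Prop := forall r : R, exists2 M : R, 0 <= M &
  forall g, flip_matched g M r -> stab_unordered lox g.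

Lemma line_inside (q : R -> X) (M r : R) : rough_line c q -> 
  mdist (P (- M)) (q (- M)) <= r -> mdist (P M) (q M) <= r ->
  forall m, - M <= m <= M -> mdist (P m) (q m) <= 5 * c + 3 * r + 2 * delta.
Proof.
move=> lq H1 H2 m /andP[m1 m2]; have MM : - M <= M by lra.
have mM : 0 <= m + M <= M - - M by apply/andP; split; lra.
have := fellow_travel hyp lineP lq MM MM H1 H2 mM.
by rewrite (_ : - M + (m + M) = m) //; ring.
Qed.

Lemma matched_inside g (M r : R) : matched g M r ->
  forall m, - M <= m <= M ->
    mdist (P m) (A g (P m)) <= 5 * c + 3 * r + 2 * delta.
Proof. by move=> [H1 H2]; exact: (line_inside (rough_line_act A g lineP) H1 H2). Qed.

Lemma flip_matched_inside g (M r : R) : flip_matched g M r ->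
  forall m, - M <= m <= M ->
    mdist (P m) (A g (P (- m))) <= 5 * c + 3 * r + 2 * delta.
Proof.
move=> [H1 H2]; apply: (line_inside (rough_line_flip lineP g)) => //=.
by rewrite opprK.
Qed.

(** An element that exchanges the endpoints reverses the line, so it cannot
    coarsely fix two points that are far apart. *)
Lemma rigid_unordered_ordered : rigid_unordered -> rigid_ordered.
Proof.
move=> H r; have c0 := c_ge0; have d0 := delta_ge0.
have [M M0 HM] := H (5 * c + 3 * r + 2 * delta).
exists (M + (200 * (c + delta) + `|r| + c + 1)).
  by have := normr_ge0 r; lra.
move=> g gm; have gi := matched_inside gm.
have r0 := normr_ge0 r; have rr := ler_norm r.
have /stab_unorderedP[//|/(swaps_bounded hyp tau_gt0 lineP)[t Ht]] : stab_unordered lox g.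
  by apply: HM; split; apply: gi; apply/andP; split; lra.
have [gm1 gm2] := gm.
have := @opposite_bound _ _ _ _ _ _ r _ (- t) (rough_line_act A g lineP) _ gm2 gm1.
have Ht' m : mdist (P m) (A g (P (- m - t))) <= 200 * (c + delta).
  by have := Ht m; rewrite opprD.
by move=> /(_ _ Ht'); lra.
Qed.

(** Two elements that reverse the same long segment differ by an element that
    coarsely fixes it, so they map the endpoints to the same pair. *)
Lemma rigid_ordered_flips : rigid_ordered -> rigid_flips.
Proof.
move=> H r; apply: contrapT => /forall2NP nflip.
have {}nflip (M : R) : 0 <= M -> exists2 g, flip_matched g M r & ~ stab_unordered lox g.
  move=> M0; have [//|/existsNP[g /not_implyP[gm gs]]] := nflip M.
  by exists g.
pose r' := 5 * c + 3 * r + 2 * delta.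
have [M1 M10 HM1] := H (2 * r').
have [g gm gs] := nflip M1 M10; apply: gs; apply/stab_unorderedP; right.
have gi := flip_matched_inside gm.
have [|t Ht] := @windows_parallel _ _ c P (fun u => A g (P (- u)))
    (r' + 200 * (c + delta)) (rough_line_flip lineP g); last first.
  exact: (bounded_swaps lox hyp tau_gt0 lineP Ht).
move=> M; pose M2 := Num.max M M1.
have M12 : M1 <= M2 by rewrite /M2 le_max lexx orbT.
have MM2 : M <= M2 by rewrite /M2 le_max lexx.
have [k km _] := nflip M2 (le_trans M10 M12).
have ki := flip_matched_inside km.
have gk m : - M1 <= m <= M1 -> mdist (P m) (A (g^-1 * k)%g (P m)) <= 2 * r'.
  move=> mM; rewrite hactM -(hact_isometry A g) hactVK.
  have mN : - M1 <= - m <= M1 by apply/andP; split; lra.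
  have mN2 : - M2 <= - m <= M2 by apply/andP; split; lra.
  have := gi _ mN; have := ki _ mN2; rewrite opprK -/r' => h1 h2.
  have := metric_triangle (A g (P m)) (P (- m)) (A k (P m)).
  by rewrite (metric_sym _ (P (- m))); lra.
have /HM1 /(ordered_bounded hyp tau_gt0 lineP)[t Ht] : matched (g^-1 * k)%g M1 (2 * r').
  by split; apply: gk; apply/andP; split; lra.
exists t => m mM.
have mM2 : - M2 <= m <= M2 by apply/andP; split; lra.
have := ki _ mM2; have := Ht (- (m + t)).
rewrite -(hact_isometry A g) -hactM mulVKg (_ : - (m + t) + t = - m); last by ring.
rewrite -/r' metric_sym => h1 h2.
have := metric_triangle (P m) (A k (P (- m))) (A g (P (- (m + t)))).
lra.
Qed.

End Rigidity.

(** * Finiteness and sequences *)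

Section Sequences.
Context {R : realType} {G : groupType} {X : metricType R}.
Variable A : hyperbolic_action G X.
Variables (h : G) (lox : loxodromic A h).
Variables (x : X) (tau c delta : R).
Hypothesis hyp : @hyperbolic_with R X delta.
Hypothesis tau_gt0 : 0 < tau.
Local Notation P := (orbit_line A h x tau).
Hypothesis lineP : rough_line c P.

Lemma mdist_quotient g k y (r : R) : mdist y (A g y) < r -> mdist y (A k y) < r ->
  mdist y (A (g^-1 * k)%g y) <= 2 * r.
Proof.
move=> h1 h2; rewrite -(hact_isometry A g) -hactM mulVKg.
by have := metric_triangle (A g y) y (A k y); rewrite (metric_sym (A g y) y); lra.
Qed.

Lemma mdist_move g y z (r : R) : mdist y (A g y) <= r ->
  mdist z (A g z) <= r + 2 * mdist y z.
Proof.
move=> h1; have := metric_triangle z y (A g z).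
have := metric_triangle y (A g y) (A g z); rewrite hact_isometry (metric_sym z y); lra.
Qed.

(** Two elements of Z differ by an element that coarsely fixes a long segment,
    so Z has at most one element. *)
Lemma rigid_finiteness : rigid_ordered lox x tau -> wwpd_finiteness lox.
Proof.
move=> H y r r0; pose r1 := 2 * r + 2 * mdist y x.
have [M M0 HM] := H (5 * c + 3 * r1 + 2 * delta).
have [N /(_ N.+1 (leqnSn _)) HN] := ray_far tau_gt0 M.
exists (2 * N.+1)%N => [|Z Za Zb]; first by rewrite mul2n double_gt0.
suff ZE g g' : Z g -> Z g' -> g = g'.
  have [[g Zg]|nZ] := pselect (exists g, Z g).
    by apply: (sub_finite_set _ (finite_set1 g)) => g' Zg'; exact: ZE.
  by apply: (sub_finite_set _ (finite_set0 G)) => g Zg; apply: nZ; exists g.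
move=> Zg Zg'; apply: contrapT => /(Zb _ _ Zg Zg'); apply.
apply/(same_left_cosetP (pairs_act1 A) (@pairs_actM _ _ _ A)).
set k := (g^-1 * g')%g.
have [g1 g2] := Za _ Zg; have [g1' g2'] := Za _ Zg'.
have k1 : mdist x (A k x) <= r1 by apply: mdist_move; exact: mdist_quotient.
have k2 : mdist (P (tau * (2 * N.+1)%N%:R)) (A k (P (tau * (2 * N.+1)%N%:R))) <= r1.
  rewrite orbit_line_nat // /r1 -[mdist y x](hact_isometry A (h ^+ (2 * N.+1))%g).
  by apply: mdist_move; apply: mdist_quotient; rewrite -hactM.
apply: (@stab_ordered_sandwich _ _ _ _ _ lox k (- N.+1%:Z) N.+1%:Z).
(* Conjugation by this power of h centres the segment at the base point. *)
apply: HM; set k' := (_ * _)%g.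
have km : matched A h x tau k' (tau * N.+1%:R) r1.
  split; rewrite mdist_conj // -[N.+1%:~R]/(N.+1%:R : R).
    by rewrite addNr orbit_line0.
  by rewrite -mulr2n -mulrnAr -mulrnA mulnC.
have ki := matched_inside hyp lineP km.
by split; apply: ki; apply/andP; split; lra.
Qed.

Lemma finiteness_no_sequence : wwpd_finiteness lox -> wwpd_no_sequence_exists lox.
Proof.
move=> H [g [dg [y [r r0 Hg]]]]; have [M M1 HM] := H y r r0.
have [I HI] := Hg M; pose Z := [set g i | i in [set i | (I <= i)%N]].
have ginj i j : g i = g j -> i = j.
  move=> gij; apply: contrapT => /dg; apply; rewrite -gij.
  by apply/(same_left_cosetP (pairs_act1 A) (@pairs_actM _ _ _ A));
     rewrite mulVg /stab /= pairs_act1.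
have finZ : finite_set Z.
  apply: HM => [_ [i /= Ii <-]|_ _ [i /= Ii <-] [j /= Ij <-] gij].
    have := HI 0%N i (leq0n _) Ii; have := HI M i (leqnn _) Ii.
    by rewrite expg0 mulg1 hact1 ![mdist (A (g i * _)%g _) _]metric_sym
      [mdist (A (g i) _) _]metric_sym.
  by apply: dg => ij; apply: gij; rewrite ij.
have fin : finite_set (range (fun i => g (I + i)%N)).
  by apply: sub_finite_set finZ => _ [i _ <-]; exists (I + i)%N => //=; rewrite leq_addr.
have [g0 [S infS HS]] := finite_range_cst_subsequence fin.
have [i Si] := infinite_setN0 infS.
apply: infS; apply: (sub_finite_set _ (finite_set1 i)) => j Sj /=.
by move/HS: Si; move/HS: Sj => <- /ginj /addnI ->.
Qed.

Lemma no_sequence_exists_forall :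
  wwpd_no_sequence_exists lox -> wwpd_no_sequence_forall lox.
Proof.
by move=> H [g [dg Hg]]; apply: H; exists g; split => //; exists x; exact: Hg.
Qed.

(** Elements outside the stabilizer that coarsely fix longer and longer segments
    fall into infinitely many cosets: if infinitely many of them lay in the coset
    of a fixed element, that element would coarsely fix the whole line. *)
Lemma no_sequence_rigid : wwpd_no_sequence_forall lox -> rigid_unordered lox x tau.
Proof.
move=> H r; apply: contrapT => /forall2NP nrig; apply: H.
have /choice[f Hf] : forall n : nat, exists g,
    matched A h x tau g n%:R r /\ ~ stab_unordered lox g.
  move=> n; have [/(_ (ler0n _ _))//|/existsNP[g /not_implyP gn]] := nrig n%:R.
  by exists g.
pose r' := 5 * c + 3 * r + 2 * delta.
have fi n m : - n%:R <= m <= n%:R -> mdist (P m) (A (f n) (P m)) <= r'.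
  by apply: (matched_inside hyp lineP); exact: (Hf n).1.
have /choice[N HN] : forall j, exists N : nat, forall n : nat, (N <= n)%N ->
    ~ stab_ordered lox ((f j)^-1 * f n)%g.
  move=> j; apply: contrapT => /forallNP nN; apply: (Hf j).2.
  apply: stab_ordered_sub.
  have [|t Ht] := @windows_parallel _ _ c P (fun u => A (f j) (P u))
      (r' + 200 * (c + delta)) (rough_line_act A (f j) lineP); last first.
    exact: (bounded_ordered lox hyp tau_gt0 lineP Ht).
  move=> M; have [n0 /(_ _ (leqnn _)) Mn0] := ray_far (ltr01 : 0 < 1 :> R) M.
  rewrite mul1r in Mn0.
  have /existsNP[n /not_implyP[n0n /contrapT]] := nN n0.
  move=> /(ordered_bounded hyp tau_gt0 lineP)[t Ht]; exists (- t) => m mM.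
  have Mn : M <= n%:R by apply: le_trans Mn0 _; rewrite ler_nat.
  have mn : - n%:R <= m <= n%:R by apply/andP; split; lra.
  have := fi _ _ mn; have := Ht (m - t).
  rewrite -(hact_isometry A (f j)) -hactM mulVKg subrK metric_sym => h1 h2.
  by have := metric_triangle (P m) (A (f n) (P m)) (A (f j) (P (m - t))); lra.
(* phi n.+1 exceeds N j for all j up to phi n, which keeps the terms of the
   subsequence in distinct cosets. *)
pose phi := fix phi (n : nat) : nat :=
  if n is n'.+1 then maxn (phi n').+1 (\max_(j < (phi n').+1) N j) else 0%N.
have phiS n : (phi n < phi n.+1)%N by rewrite /= leq_maxl.
have phi_ge n : (n <= phi n)%N by elim: n => // n IH; exact: leq_ltn_trans IH (phiS n).
have phi_le i j : (i <= j)%N -> (phi i <= phi j)%N.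
  move=> ij; rewrite -(subnK ij); elim: (j - i)%N => // n IH.
  by rewrite addSn; apply: leq_trans IH _; exact: ltnW (phiS _).
have phiN i j : (i < j)%N -> (N (phi i) <= phi j)%N.
  case: j => // j; rewrite ltnS => /phi_le ij /=; rewrite leq_max; apply/orP; right.
  by have := @leq_bigmax _ (fun k : 'I_(phi j).+1 => N k) (Ordinal (ij : (phi i < (phi j).+1)%N)).
exists (f \o phi); split.
  have lt i j : (i < j)%N -> ~ same_left_coset (stab_ordered lox) (f (phi i)) (f (phi j)).
    move=> /phiN ij /(same_left_cosetP (pairs_act1 A) (@pairs_actM _ _ _ A)).
    exact: HN.
  move=> i j /eqP; rewrite neq_ltn => /orP[/lt//|/lt H [k [ki kj]]].
  by apply: H; exists k.
move=> y; exists (`|r'| + 2 * mdist x y + 1).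
  by have := mdist_ge0 x y; have := normr_ge0 r'; lra.
move=> M; exists (Num.bound (tau * M%:R)) => m i mM Ii.
have tM : tau * m%:R <= (phi i)%:R.
  apply: (@le_trans _ _ (tau * M%:R)); first by rewrite ler_pM2l // ler_nat.
  apply: ltW; apply: lt_le_trans (archi_boundP _) _.
    by rewrite mulr_ge0 // ltW.
  by rewrite ler_nat (leq_trans Ii).
have := fi (phi i) (tau * m%:R); rewrite orbit_line_nat // => /(_ _).
have t0 : 0 <= tau * m%:R by rewrite mulr_ge0 // ltW.
have bnd : - (phi i)%:R <= tau * m%:R <= (phi i)%:R by apply/andP; split; lra.
move=> /(_ bnd) /(mdist_move (A (h ^+ m)%g y)).
rewrite hact_isometry -!hactM metric_sym; have := ler_norm r'; lra.
Qed.

End Sequences.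

(** * Discreteness of the orbit of the endpoints *)

Section Discreteness.
Context {R : realType} {G : groupType} {X : metricType R}.
Variable A : hyperbolic_action G X.
Variables (h : G) (lox : loxodromic A h).
Variables (x : X) (tau c delta : R).
Hypothesis hyp : @hyperbolic_with R X delta.
Hypothesis tau_gt0 : 0 < tau.
Local Notation P := (orbit_line A h x tau).
Hypothesis lineP : rough_line c P.
Local Notation E := (endpoints lox).

Lemma orbit_line_step (t : R) : exists n : int, forall u,
  mdist (A (expgz h n) (P u)) (P (u + t)) <= tau + c.
Proof.
exists (Num.floor (t / tau)) => u; rewrite orbit_line_act //.
have := floor_itv (t / tau); set n := Num.floor _.
rewrite intrD ler_pdivlMr // ltr_pdivrMr // => /andP[n1 n2].
have uv : u + tau * n%:~R <= u + t by lra.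
by have := lineP uv; lra.
Qed.

(** The line and its image under g pass near each other at P 0, P M and P (- M), so
    their rays towards the corresponding ends separate only after time M. *)
Lemma matched_close g (M r : R) : 0 <= M -> matched A h x tau g M r ->
  close_pairs (P 0) (M - 2 * c - 2 * (5 * c + 3 * r + 2 * delta) - 2 * delta)
    E (pairs_act A g E).
Proof.
move=> M0 gm; have gi := matched_inside hyp lineP gm.
have [Em Ep] := has_ends_orbit lox x tau_gt0.
have [Fm Fp] := has_ends_act A g (has_ends_orbit lox x tau_gt0).
have M1 : - M <= - M <= M by apply/andP; split; lra.
have M2 : - M <= M <= M by apply/andP; split; lra.
have M3 : - M <= 0 <= M by apply/andP; split; lra.
split; rewrite /= ?endpoints_pair /=.
  apply: (boundary_product_ge Em Fm); rewrite -{1}oppr0.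
  apply: (match_product hyp tau_gt0 (rough_line_rev lineP) (rough_line_flip lineP g) M0).
    exact: gi.
  by rewrite oppr0; exact: gi.
apply: (boundary_product_ge Ep Fp).
apply: (match_product hyp tau_gt0 lineP (rough_line_act A g lineP) M0); exact: gi.
Qed.

Lemma close_rigid (rho : R) (S : set G) :
  (forall g, close_pairs (P 0) rho E (pairs_act A g E) -> S g) ->
  forall r : R, exists2 M : R, 0 <= M & forall g, matched A h x tau g M r -> S g.
Proof.
move=> H r; pose b := 2 * c + 2 * (5 * c + 3 * r + 2 * delta) + 2 * delta.
exists (`|rho + b|) => [|g gm]; first exact: normr_ge0.
apply: H; have [H1 H2] := matched_close (normr_ge0 _) gm.
have le : rho <= `|rho + b| - 2 * c - 2 * (5 * c + 3 * r + 2 * delta) - 2 * delta.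
  by have := ler_norm (rho + b); rewrite /b; lra.
by split; [apply: le_trans H1|apply: le_trans H2]; rewrite lee_fin.
Qed.

Lemma discrete_unordered_rigid :
  wwpd_discrete_unordered lox -> rigid_unordered lox x tau.
Proof.
move=> H; have orb g : Defs.orbit (boundary2_act A) (endpoint_set lox)
    (unordered (pairs_act A g E)).
  by exists g => //; rewrite -boundary2_act_unordered.
have := H _ (orb 1%g); rewrite pairs_act1 => -[_ [V /(nbhs_pairs2 (P 0))[rho Hrho] VE]].
apply: (@close_rigid rho) => g /Hrho Vg.
have : (V `&` Defs.orbit (boundary2_act A) (endpoint_set lox)) (unordered (pairs_act A g E)).
  by split => //; exact: orb.
by rewrite VE /= -boundary2_act_unordered.
Qed.

Lemma discrete_ordered_rigid :
  wwpd_discrete_ordered lox -> rigid_ordered lox x tau.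
Proof.
move=> H; have orb g : Defs.orbit (pairs_act A) E (pairs_act A g E) by exists g.
have := H _ (orb 1%g); rewrite pairs_act1 => -[_ [V /(nbhs_pairs (P 0))[rho Hrho] VE]].
apply: (@close_rigid rho) => g /Hrho Vg.
have : (V `&` Defs.orbit (pairs_act A) E) (pairs_act A g E) by split => //; exact: orb.
by rewrite VE.
Qed.

Local Notation r1 := (50 * (c + delta) + (tau + c)).

(** Translates of the line with nearby endpoints match on a long segment, after
    a translation along the line. *)
Lemma close_matched g k (M rho : R) : 0 <= M -> M + 3 * c + 4 * delta + 1 < rho ->
  close_pairs (A g (P 0)) rho (pairs_act A g E) (pairs_act A k E) ->
  exists n : int, matched A h x tau (g^-1 * k * expgz h n)%g M r1.
Proof.
move=> M0 Mrho; rewrite /close_pairs /= endpoints_pair /= => -[H1 H2].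
have ends := has_ends_orbit lox x tau_gt0.
have [t Ht] := close_ends_fellow_travel hyp tau_gt0 (rough_line_act A g lineP)
  (rough_line_act A k lineP) (has_ends_act A g ends) (has_ends_act A k ends)
  M0 Mrho H1 H2.
have [n Hn] := orbit_line_step t; exists n.
have match_ m : - M <= m <= M -> mdist (P m) (A (g^-1 * k * expgz h n)%g (P m)) <= r1.
  move=> /Ht; rewrite -(hact_isometry A g (P m)) -hactM -mulgA mulVKg hactM.
  have := metric_triangle (A g (P m)) (A k (P (m + t))) (A k (A (expgz h n) (P m))).
  by rewrite [mdist (A k _) (A k _)]metric_sym hact_isometry; have := Hn m; lra.
by split; apply: match_; apply/andP; split; lra.
Qed.

Lemma close_flip_matched g k (M rho : R) : 0 <= M -> M + 3 * c + 4 * delta + 1 < rho ->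
  (rho%:E <= boundary_product (A g (P 0%R)) (boundary_act A g (repelling_end lox))
    (boundary_act A k (attracting_end lox)))%E ->
  (rho%:E <= boundary_product (A g (P 0%R)) (boundary_act A g (attracting_end lox))
    (boundary_act A k (repelling_end lox)))%E ->
  exists n : int, flip_matched A h x tau (g^-1 * k * expgz h n)%g M r1.
Proof.
move=> M0 Mrho H1 H2.
have ends := has_ends_orbit lox x tau_gt0.
have [t Ht] := close_ends_fellow_travel hyp tau_gt0 (rough_line_act A g lineP)
  (rough_line_flip lineP k) (has_ends_act A g ends) (has_ends_flip lox x tau_gt0 k)
  M0 Mrho H1 H2.
have [n Hn] := orbit_line_step (- t); exists n.
have match_ m : - M <= m <= M ->
    mdist (P m) (A (g^-1 * k * expgz h n)%g (P (- m))) <= r1.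
  move=> /Ht; rewrite -(hact_isometry A g (P m)) -hactM -mulgA mulVKg hactM.
  have := metric_triangle (A g (P m)) (A k (P (- (m + t)))) (A k (A (expgz h n) (P (- m)))).
  rewrite [mdist (A k _) (A k _)]metric_sym hact_isometry.
  by have := Hn (- m); rewrite -opprD; lra.
split; last by apply: match_; apply/andP; split; lra.
by rewrite -{2}(opprK M); apply: match_; apply/andP; split; lra.
Qed.

Lemma rigid_discrete_ordered :
  rigid_ordered lox x tau -> wwpd_discrete_ordered lox.
Proof.
move=> H; have [M M0 HM] := H r1.
pose rho := M + 3 * c + 4 * delta + 2.
have Mrho : M + 3 * c + 4 * delta + 1 < rho by rewrite /rho; lra.
move=> _ [g _ <-]; split; first by rewrite inE; exists g.
exists (close_pairs (A g (P 0)) rho (pairs_act A g E)).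
  exact: (close_pairs_nbhs hyp).
apply/seteqP; split=> [f [fE [k _ kf]]|_ ->] /=.
  move: fE; rewrite -kf => /(close_matched M0 Mrho)[n /HM].
  rewrite -[(g^-1 * k)%g]mul1g => /(@stab_ordered_sandwich _ _ _ _ _ lox _ 0 n).
  by move=> /(stab_act_eq (pairs_act1 A) (@pairs_actM _ _ _ A)) ->.
split; last by exists g.
by split; exact: boundary_product_self.
Qed.

(** When two unordered pairs are close, the ordered pairs are close either directly
    or after exchanging the ends of one of them; in the second case the group
    element is flip matched instead of matched. *)
Lemma rigid_discrete_unordered :
  rigid_ordered lox x tau -> wwpd_discrete_unordered lox.
Proof.
move=> H; have [M1 M10 HM1] := H r1.
have [M2 M20 HM2] := rigid_ordered_flips hyp tau_gt0 lineP H r1.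
have c0 := rough_line_ge0 lineP; have d0 := hyp.1.
pose rho := M1 + M2 + 3 * c + 4 * delta + 2.
have Mrho1 : M1 + 3 * c + 4 * delta + 1 < rho by rewrite /rho; lra.
have Mrho2 : M2 + 3 * c + 4 * delta + 1 < rho by rewrite /rho; lra.
move=> _ [g _ <-]; split; first by rewrite inE; exists g.
rewrite [boundary2_act A g _]boundary2_act_unordered.
exists [set unordered f | f in close_pairs (A g (P 0)) rho (pairs_act A g E)].
  exact: (close_pairs_nbhs2 hyp).
apply/seteqP; split=> [_ [[f fE <-] [k _]]|_ ->] /=; last first.
  split; last by exists g => //; rewrite -boundary2_act_unordered.
  by exists (pairs_act A g E) => //; split; exact: boundary_product_self.
rewrite [boundary2_act A k _]boundary2_act_unordered => kf; rewrite -kf.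
rewrite -!boundary2_act_unordered; apply: esym.
apply/(stab_act_eq (boundary2_act1 A) (@boundary2_actM _ _ _ A)).
have sandwich n : stab_unordered lox (g^-1 * k * expgz h n)%g ->
    stab_unordered lox (g^-1 * k)%g.
  move=> Hs; apply: (@stab_unordered_sandwich _ _ _ _ _ lox _ 0 n).
  by rewrite [expgz h 0]expg0 mul1g.
have [fk|fk] := unordered_eq (esym kf).
  have {}fk : f = pairs_act A k E by exact: val_inj.
  move: fE; rewrite fk => /(close_matched M10 Mrho1)[n /HM1].
  by move=> /stab_ordered_sub /sandwich.
move: fE; rewrite /close_pairs fk /= endpoints_pair /= => -[H1 H2].
have [n /HM2] := close_flip_matched M20 Mrho2 H1 H2.
exact: sandwich.
Qed.

End Discreteness.

(** * Projections to quasi-axes *)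

Section QuasiAxes.
Context {R : realType} {G : groupType} {X : metricType R}.
Variable A : hyperbolic_action G X.
Variables (h : G) (lox : loxodromic A h).
Variables (x : X) (tau c delta : R).
Hypothesis hyp : @hyperbolic_with R X delta.
Hypothesis tau_gt0 : 0 < tau.
Local Notation P := (orbit_line A h x tau).
Hypothesis lineP : rough_line c P.

Lemma orbit_line_int (n : int) : P (tau * n%:~R) = A (expgz h n) x.
Proof. by rewrite -[LHS](congr1 _ (add0r _)) -orbit_line_act // orbit_line0. Qed.

Lemma moves_base_point : 0 < mdist x (A h x).
Proof.
rewrite mdist_gt0; apply/eqP => xh.
have fixn n : A (h ^+ n)%g x = x.
  by elim: n => [|n IH]; rewrite ?expg0 ?hact1 // expgSr hactM -xh.
have [n /(_ n (leqnn _)) Hn] := ray_far tau_gt0 (c + 1).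
have n0 : 0 <= tau * n%:R by rewrite mulr_ge0 // ltW.
by have := lineP n0; rewrite orbit_line_nat // fixn orbit_line0 mdistxx; lra.
Qed.

(** The translates of a geodesic segment from x to h x by the powers of h form a
    continuous path. It is 1-Lipschitz, and the lower bound for distances comes
    from the orbit of x. *)
Lemma quasi_axis_exists : exists l (T : R), [/\ 0 < T, quasi_axis A h l &
  forall n : int, l (T * n%:~R) = A (expgz h n) x].
Proof.
have [gam [g0 gT gd]] := hact_geodesic A x (A h x).
set T := mdist x (A h x) in gT gd; have T0 : 0 < T := moves_base_point.
pose l t := A (expgz h (Num.floor (t / T))) (gam (t - T * (Num.floor (t / T))%:~R)).
have fl t : 0 <= t - T * (Num.floor (t / T))%:~R < T.
  have := floor_itv (t / T); rewrite intrD ler_pdivlMr // ltr_pdivrMr //.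
  by move=> /andP[? ?]; apply/andP; split; lra.
have lint (n : int) : l (T * n%:~R) = A (expgz h n) x.
  by rewrite /l [T * _]mulrC mulfK ?gt_eqF // intrKfloor [T * _]mulrC subrr g0.
have ends t (k := Num.floor (t / T)) :
    mdist (A (expgz h k) x) (l t) = t - T * k%:~R /\
    mdist (l t) (A (expgz h (k + 1)) x) = T * (k%:~R + 1) - t.
  have /andP[f1 f2] := fl t; rewrite expgzD hactM /l -/k !hact_isometry /= expg1.
  rewrite -/k in f1 f2; have i0 : 0 <= (0 : R) <= T by rewrite lexx ltW.
  have iT : 0 <= T <= T by rewrite lexx ltW.
  have it : 0 <= t - T * k%:~R <= T by apply/andP; split; lra.
  rewrite -{1}g0 -gT !gd // sub0r normrN ger0_norm //; split => //.
  by rewrite ler0_norm; lra.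
have step (k : int) (n : nat) :
    mdist (A (expgz h k) x) (A (expgz h (k + n%:Z)) x) <= T * n%:R.
  rewrite expgzD hactM hact_isometry /=; elim: n => [|n IH].
    by rewrite expg0 hact1 mdistxx mulr0.
  have := metric_triangle x (A (h ^+ n)%g x) (A (h ^+ n.+1)%g x).
  have E : mdist (A (h ^+ n)%g x) (A (h ^+ n.+1)%g x) = T.
    by rewrite expgSr hactM hact_isometry.
  by rewrite E -natr1; lra.
have lip s t : s <= t -> mdist (l s) (l t) <= t - s.
  move=> st; have [Es1 Es2] := ends s; have [Et1 Et2] := ends t.
  set k := Num.floor (s / T) in Es1 Es2; set k' := Num.floor (t / T) in Et1 Et2.
  have kk : k <= k' by apply: le_floor; rewrite ler_pM2r ?invr_gt0.
  move: kk; rewrite le_eqVlt => /orP[/eqP kk|kk].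
    have /andP[a1 a2] := fl s; have /andP[b1 b2] := fl t.
    rewrite /l -/k -/k' -kk hact_isometry gd; last 2 first.
    - by rewrite -/k in a1 a2; apply/andP; split; lra.
    - by rewrite -/k' -kk in b1 b2; apply/andP; split; lra.
    by rewrite ler0_norm; lra.
  have [n En] : exists n : nat, k' = k + 1 + n%:Z.
    by exists (absz (k' - (k + 1))%R); rewrite gez0_abs ?subr_ge0 ?lezD1 // [RHS]addrC subrK.
  have := step (k + 1) n; rewrite -En.
  have := metric_triangle (l s) (A (expgz h (k + 1)) x) (l t).
  have := metric_triangle (A (expgz h (k + 1)) x) (A (expgz h k') x) (l t).
  rewrite Et1 Es2 En !intrD -[n%:~R]/(n%:R : R); lra.
have lower s t : s <= t -> tau * (t - s) <= T * (mdist (l s) (l t) + c + 2 * T + tau).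
  move=> st; have [Es1 _] := ends s; have [Et1 _] := ends t.
  have := fl s; have := fl t.
  set k := Num.floor (s / T) in Es1 *; set k' := Num.floor (t / T) in Et1 *.
  move=> /andP[b1 b2] /andP[a1 a2].
  have := rough_line_ge (tau * k%:~R) (tau * k'%:~R) lineP; rewrite !orbit_line_int.
  have := ler_norm (- (tau * k%:~R - tau * k'%:~R)); rewrite normrN.
  have := metric_triangle (A (expgz h k) x) (l s) (A (expgz h k') x).
  have := metric_triangle (l s) (l t) (A (expgz h k') x).
  rewrite [mdist (l t) _]metric_sym => d1 d2 d3 d4.
  have d5 : tau * (k'%:~R - k%:~R) <= mdist (l s) (l t) + c + 2 * T by lra.
  have d6 : T * (tau * (k'%:~R - k%:~R)) <= T * (mdist (l s) (l t) + c + 2 * T).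
    by rewrite ler_pM2l.
  have d7 : tau * (t - s) <= tau * (T * (k'%:~R - k%:~R) + T).
    by rewrite ler_pM2l //; lra.
  lra.
exists l, T; split=> //; split.
- move=> t; apply/metricType_numDomainType.cvgrPdist_le => e e0.
  apply/nbhs_ballP; exists e => //= s; rewrite /ball /= => /ltW ts.
  apply: le_trans ts; have [st|/ltW st] := leP s t.
    by rewrite metric_sym ger0_norm ?subr_ge0 // lip.
  by rewrite ler0_norm ?subr_le0 // opprB lip.
- have c0 := rough_line_ge0 lineP.
  have cT : 0 <= c + 2 * T + tau by rewrite !addr_ge0 ?mulr_ge0 // ltW.
  exists (Num.max 1 (T / tau)), (c + 2 * T + tau); split.
  - by rewrite le_max lexx.
  - exact: cT.
  move=> s t; wlog st : s t / s <= t.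
    move=> W; have [|/ltW] := leP s t; first exact: W.
    by rewrite metric_sym distrC; exact: W.
  have := lip _ _ st; have := lower _ _ st.
  rewrite ler0_norm ?subr_le0 // opprB => lo up.
  have ts : 0 <= t - s by rewrite subr_ge0.
  have K1 : 1 <= Num.max 1 (T / tau) by rewrite le_max lexx.
  have K0 : 0 < Num.max 1 (T / tau) by lra.
  apply/andP; split; last first.
    have : 1 * (t - s) <= Num.max 1 (T / tau) * (t - s) by rewrite ler_wpM2r.
    by rewrite mul1r; lra.
  have : (Num.max 1 (T / tau))^-1 * (t - s) <= (T / tau)^-1 * (t - s).
    rewrite ler_wpM2r // lef_pV2 ?posrE ?divr_gt0 //.
    by rewrite le_max lexx orbT.
  have : (T / tau)^-1 * (t - s) <= mdist (l s) (l t) + c + 2 * T + tau.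
    by rewrite invf_div mulrAC ler_pdivrMr // [leRHS]mulrC.
  lra.
exists T => // t; rewrite /l.
have -> : (t + T) / T = t / T + 1 by rewrite mulrDl divff ?gt_eqF.
rewrite floorDrz ?rpred1 // floor1 intrD [_ + 1]addrC expgzD hactM /= expg1.
by congr (A h (A _ (gam _))); rewrite addrC; lra.
Qed.

(** The distance from y to l t tends to infinity with t, so its minimum over a large
    compact interval is a global one. *)
Lemma closest_point_exists (l : R -> X) y : quasi_axis A h l ->
  exists t, forall s, mdist y (l t) <= mdist y (l s).
Proof.
move=> [cl [K [C [K1 C0 qi]]] _].
pose f t := mdist y (l t).
have cf : continuous f.
  move=> t; apply: ((@cvgrPdist_le R R^o _ (nbhs t) _ f (f t)).2 _) => e e0.
  have le := metricType_numDomainType.cvgr_dist_le (cl t) e0.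
  near=> s; have : mdist (l t) (l s) <= e by near: s; exact: le.
  rewrite /f ler_norml.
  have := metric_triangle y (l s) (l t); have := metric_triangle y (l t) (l s).
  by rewrite (metric_sym (l s)) => ? ? ?; apply/andP; split; lra.
pose L := K * (C + 2 * mdist y (l 0)).
have y0 := mdist_ge0 y (l 0).
have L0 : 0 <= L by apply: mulr_ge0; lra.
have LL : - L <= L by lra.
have [t _ Ht] := EVT_min LL (continuous_subspaceT cf); exists t => s.
have [sL|sL] := leP `|s| L; first by apply: Ht; rewrite in_itv /= -ler_norml.
have K0 : 0 < K by lra.
have f0 : f t <= f 0 by apply: Ht; rewrite in_itv /=; apply/andP; split; lra.
have := qi s 0; rewrite subr0 => /andP[+ _].
have : C + 2 * mdist y (l 0) <= K^-1 * `|s| by rewrite ler_pdivlMl //; exact: ltW.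
have := metric_triangle (l s) y (l 0); rewrite (metric_sym (l s) y).
by rewrite /f in f0 *; lra.
Unshelve. all: by end_near.
Qed.

(** If g coarsely fixes P (- M) and P M, then the projection of the image of the
    quasi-axis to the quasi-axis contains points close to both of them. *)
Lemma projection_rigid : wwpd_projection lox -> rigid_unordered lox x tau.
Proof.
move=> H r; have [l [T [T0 ql lint]]] := quasi_axis_exists.
have [D D0 HD] := H l ql.
have [N /(_ N (leqnn _)) HN] := ray_far tau_gt0 (D + 4 * `|r| + c + 1).
have N0 : 0 <= tau * N%:R by rewrite mulr_ge0 // ltW.
exists (tau * N%:R) => // g [gm1 gm2]; apply: contrapT => gs.
have /choice[f' Hf'] y := closest_point_exists y ql.
have cp : closest_point_map (A g @` range l) (range l) (l \o f').
  by move=> y _; split=> [|_ [s _ <-]] /=; [exists (f' y)|exact: Hf'].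
have := HD g gs _ cp; apply/negP; rewrite -ltNge.
pose yp := A g (l (T * (N%:Z)%:~R)); pose ym := A g (l (T * (- N%:Z)%:~R)).
have Np : l (T * (N%:Z)%:~R) = P (tau * N%:R) by rewrite lint -orbit_line_int.
have Nm : l (T * (- N%:Z)%:~R) = P (- (tau * N%:R)).
  by rewrite lint -orbit_line_int -mulrN -[in RHS](rmorphN intr N%:Z).
apply: (@lt_le_trans _ _ (mdist (l (f' ym)) (l (f' yp)))%:E); last first.
  apply: ereal_sup_ubound; exists (l (f' ym), l (f' yp)) => //=; split.
    by exists ym => //; exists (l (T * (- N%:Z)%:~R)) => //; exists (T * (- N%:Z)%:~R).
  by exists yp => //; exists (l (T * (N%:Z)%:~R)) => //; exists (T * (N%:Z)%:~R).
have hp := Hf' yp (T * (N%:Z)%:~R); have hm := Hf' ym (T * (- N%:Z)%:~R).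
rewrite Np [X in _ <= X]metric_sym in hp.
rewrite Nm [X in _ <= X]metric_sym in hm.
have ep : mdist (P (tau * N%:R)) yp <= r by rewrite /yp Np.
have em : mdist (P (- (tau * N%:R))) ym <= r by rewrite /ym Nm.
have t1 := metric_triangle (P (- (tau * N%:R))) ym (P (tau * N%:R)).
have t2 := metric_triangle ym (l (f' ym)) (P (tau * N%:R)).
have t3 := metric_triangle (l (f' ym)) (l (f' yp)) (P (tau * N%:R)).
have t4 := metric_triangle (l (f' yp)) yp (P (tau * N%:R)).
rewrite (metric_sym yp) (metric_sym (l (f' yp)) yp) in t4.
have NN : - (tau * N%:R) <= tau * N%:R by lra.
have := lineP NN; rewrite lte_fin; have := ler_norm r; lra.
Qed.

(** Both l and P are moved along themselves by h, so it suffices to compare them on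
    a fundamental domain, where they are bounded. *)
Lemma quasi_axis_near (l : R -> X) : quasi_axis A h l -> exists C : R,
  (forall t, exists u, mdist (l t) (P u) <= C) /\
  (forall u, exists t, mdist (P u) (l t) <= C).
Proof.
move=> [_ [K [C [K1 C0 qi]]] [T T0 hl]].
have hlZ (n : int) t : A (expgz h n) (l t) = l (t + T * n%:~R).
  elim/int_rect: n t => [|n IH|n IH] t; first by rewrite /= expg0 hact1 mulr0 addr0.
    by rewrite -[n.+1]addn1 PoszD expgz1D hactM hl IH intrD mulrDr mulr1; congr l; ring.
  rewrite -[n.+1]addn1 PoszD opprD expgzB1 hactM.
  have {1}-> : t = (t - T) + T by rewrite subrK.
  rewrite -hl hactK IH intrD mulrDr rmorphN /= mulrN1; congr l; ring.
exists (K * T + C + mdist (l 0) x).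
have KT : 0 <= K * T by apply: mulr_ge0; lra.
split=> t; last first.
  exists (T * (Num.floor (t / tau))%:~R); rewrite -[X in l X]add0r -hlZ /orbit_line.
  by rewrite hact_isometry metric_sym; lra.
pose k := Num.floor (t / T); exists (tau * k%:~R); rewrite orbit_line_int.
rewrite (_ : l t = A (expgz h k) (l (t - T * k%:~R))); last by rewrite hlZ subrK.
rewrite hact_isometry.
have := metric_triangle (l (t - T * k%:~R)) (l 0) x.
have /andP[_] := qi (t - T * k%:~R) 0.
have := floor_itv (t / T); rewrite -/k intrD ler_pdivlMr // ltr_pdivrMr //.
move=> /andP[k1 k2]; rewrite subr0 ger0_norm; last by lra.
have : K * (t - T * k%:~R) <= K * T by rewrite ler_pM2l; lra.
lra.
Qed.

(** If the projection of the image of l is large, the image under g of the orbit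
    line runs along the orbit line for a long time, in one of the two directions;
    translating along both lines by powers of h, one gets an element that
    coarsely fixes or reverses a long segment centred at the base point. *)
Lemma rigid_projection : rigid_ordered lox x tau -> wwpd_projection lox.
Proof.
move=> rig l ql; have [C [lP Pl]] := quasi_axis_near ql.
have c0 := rough_line_ge0 lineP; have d0 := hyp.1.
have C0 : 0 <= C by have [u Hu] := lP 0; apply: le_trans Hu; exact: mdist_ge0.
pose r := 2 * (tau + c) + 50 * (4 * C + c + delta).
have [M1 M10 HM1] := rig r.
have [M2 M20 HM2] := rigid_ordered_flips hyp tau_gt0 lineP rig r.
pose D := 2 * C + c + 2 * (M1 + M2) + 2 * (4 * C) + 7 * c + 5 * delta.
exists D => [|g gs f fcp]; first by rewrite /D; lra.
apply: ge_ereal_sup => _ [[_ _] /= [[y ly <-] [z lz <-]] <-]; rewrite lee_fin.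
rewrite leNgt; apply/negP => Dyz; apply: gs.
have near_proj y0 : (A g @` range l) y0 -> exists i a,
    mdist (f y0) (P a) <= C /\
    forall n, mdist (A g (P i)) (P a) <= mdist (A g (P i)) (P n) + 4 * C.
  move=> y0l; have [[t _ Et] fmin] := fcp _ y0l.
  case: y0l fmin Et => [_ [s _ <-] <-] fmin Et.
  have [i Hi] := lP s; have [a Ha] := lP t; exists i, a.
  rewrite -Et in fmin *; split=> // n; have [t' Ht'] := Pl n.
  have := fmin (l t') (ex_intro2 _ _ t' I erefl).
  have := metric_triangle (A g (P i)) (A g (l s)) (P a).
  have := metric_triangle (A g (l s)) (l t) (P a).
  have := metric_triangle (A g (l s)) (A g (P i)) (l t').
  have := metric_triangle (A g (P i)) (P n) (l t').
  by rewrite !hact_isometry (metric_sym (P i)); lra.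
have [i [a [Ha Hi]]] := near_proj _ ly; have [j [b [Hb Hj]]] := near_proj _ lz.
have abD : D - 2 * C - c < `|a - b|.
  have := metric_triangle (f y) (P a) (f z); have := metric_triangle (P a) (P b) (f z).
  by rewrite (metric_sym (P b)); have := rough_line_le a b lineP; lra.
wlog ab : i j a b Hi Hj abD {Ha Hb} / a <= b.
  move=> W; have [|/ltW] := leP a b; first exact: (W i j).
  by apply: (W j i) => //; rewrite distrC.
rewrite ler0_norm ?subr_le0 // in abD; rewrite /D in abD.
have e0 : 0 <= 4 * C by lra.
have [|s [t [sE Hst]]] := projection_fellow_travel hyp lineP (rough_line_act A g lineP)
  e0 Hi Hj; first by lra.
pose M := M1 + M2.
have [n1 Hn1] := orbit_line_step tau_gt0 lineP (a + M).
have [n2 Hn2] := orbit_line_step tau_gt0 lineP (s * M + t).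
pose k := (expgz h (- n1) * g * expgz h n2)%g.
have km m : - M <= m <= M -> mdist (P m) (A k (P (s * m))) <= r.
  move=> /andP[m1 m2].
  rewrite -(hact_isometry A (expgz h n1)) -hactM /k !mulgA expgzN mulgV mul1g !hactM.
  have mab : 0 <= m + M <= b - a by apply/andP; split; rewrite /M in m1 m2 *; lra.
  have := Hst _ mab; have := Hn1 m; have := Hn2 (s * m).
  rewrite (_ : s * m + (s * M + t) = s * (m + M) + t); last by ring.
  rewrite (_ : m + (a + M) = a + (m + M)); last by ring.
  set u := s * (m + M) + t; set v := a + (m + M).
  have := metric_triangle (A (expgz h n1) (P m)) (P v) (A g (A (expgz h n2) (P (s * m)))).
  have := metric_triangle (P v) (A g (P u)) (A g (A (expgz h n2) (P (s * m)))).
  by rewrite hact_isometry (metric_sym (P u)) /r; lra.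
apply: (@stab_unordered_sandwich _ _ _ _ _ lox g (- n1) n2); rewrite -/k.
have [M1M M2M] : M1 <= M /\ M2 <= M by rewrite /M; split; lra.
case: sE km => -> km.
  apply: stab_ordered_sub; apply: HM1; split.
    by have := km (- M1); rewrite mul1r; apply; apply/andP; split; lra.
  by have := km M1; rewrite mul1r; apply; apply/andP; split; lra.
apply: HM2; split.
  by have := km (- M2); rewrite mulN1r opprK; apply; apply/andP; split; lra.
by have := km M2; rewrite mulN1r; apply; apply/andP; split; lra.
Qed.

End QuasiAxes.

(** * Fixed points of loxodromic elements *)

Section FixedPoints.
Context {R : realType} {G : groupType} {X : metricType R}.
Variable A : hyperbolic_action G X.

Lemma not_asymptotic_bounded (delta : R) (s t : nat -> X) o :
  @hyperbolic_with R X delta ->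
  converges_at_infinity s -> converges_at_infinity t -> ~ asymptotic s t ->
  exists (C : R) (N : nat), forall i j, (N <= i)%N -> (N <= j)%N ->
    gromov_product o (s i) (t j) <= C.
Proof.
move=> hyp ss tt st.
have [r nr] : exists r, ~ eventually_product_ge o s t r.
  by apply/existsNP => H; apply: st; exact: asymptotic_of_product H.
have [N1 H1] := asymptotic_product o (r + 2 * delta) ss.
have [N2 H2] := asymptotic_product o (r + 2 * delta) tt.
exists (r + 2 * delta), (maxn N1 N2) => n m; rewrite !geq_max.
move=> /andP[n1 _] /andP[_ m2]; rewrite leNgt; apply/negP => nm; apply: nr.
exists (maxn N1 N2) => i j; rewrite !geq_max => /andP[i1 _] /andP[_ j2].
have h1 := H1 i n i1 n1; have h2 := H2 m j m2 j2.
have d0 := hyp.1.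
have := hyp.2 o (s i) (s n) (t m); have := hyp.2 o (s i) (t m) (t j).
by rewrite !lerBlDr !ge_min => /orP[] h3 /orP[] h4; lra.
Qed.

(** If a fixed point differs from both endpoints, then a sequence s converging to
    it projects to a bounded part of the line, and the sequence h^k s projects
    to a translate of this part; for large k the two sequences then diverge
    from each other. *)
Lemma loxodromic_fixed_points h (lox : loxodromic A h) a :
  boundary_act A h a = a -> a = repelling_end lox \/ a = attracting_end lox.
Proof.
move=> ha; apply: contrapT => /not_orP[nm np].
have [x [tau [c [tau0 lineP]]]] := loxodromic_orbit_line lox.
have [delta hyp] := hyperbolic_const (hact_hyperbolic A) (inhabits x).
have hX := hact_hyperbolic A; have d0 := hyp.1.
set P := orbit_line A h x tau in lineP.
have [em ep] := has_ends_orbit lox x tau0.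
have [s as_] := boundary_representative a.
have cs := boundary_converges as_.
have [C1 [N1 H1]] : exists (C : R) (N : nat), forall i j, (N <= i)%N -> (N <= j)%N ->
    gromov_product x (s i) (P (- (tau * j%:R))) <= C.
  apply: (not_asymptotic_bounded x hyp cs (boundary_converges em)) => H.
  exact/nm/(asymptotic_limits hX as_ em).
have [C2 [N2 H2]] : exists (C : R) (N : nat), forall i j, (N <= i)%N -> (N <= j)%N ->
    gromov_product x (s i) (P (tau * j%:R)) <= C.
  apply: (not_asymptotic_bounded x hyp cs (boundary_converges ep)) => H.
  exact/np/(asymptotic_limits hX as_ ep).
have [N3 H3] := ray_far tau0 (C1 + C2 + c + delta + 1).
pose k := maxn N1 (maxn N2 N3).
have [k1 k2 k3] : [/\ (N1 <= k)%N, (N2 <= k)%N & (N3 <= k)%N].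
  by rewrite /k !leq_max !leqnn !orbT.
have hka : boundary_act A (h ^+ k)%g a = a.
  exact: (stab_expgz (@boundary_act1 _ _ _ A) (@boundary_actM _ _ _ A) (Posz k) ha).
have shs : asymptotic s (A (h ^+ k)%g \o s).
  apply/(asymptotic_limits hX as_ (boundary_class_act A (h ^+ k)%g as_)).
  by rewrite hka.
have [N4 H4] := asymptotic_product x (C2 + delta + 1) shs.
pose n := maxn k N4; have kn : (k <= n)%N := leq_maxl _ _.
have {}H4 := H4 n n (leq_maxr _ _) (leq_maxr _ _).
have {}H1 := H1 n k (leq_trans k1 kn) k1; have {}H2 := H2 n k (leq_trans k2 kn) k2.
have {}H3 := H3 k k3; rewrite /= in H4; set y := s n in H1 H2 H4.
have tk : 0 <= tau * k%:R by rewrite mulr_ge0 // ltW.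
have mtk : - (tau * k%:R) <= 0 by rewrite oppr_le0.
have l1 := lineP _ _ tk; have l2 := lineP _ _ mtk.
rewrite /P orbit_line0 -/P in l1 l2.
have e1 : mdist x (A (h ^+ k)%g y) = mdist (P (- (tau * k%:R))) y.
  rewrite -[RHS](hact_isometry A (h ^+ k)%g) -[(h ^+ k)%g]/(expgz h k).
  by rewrite orbit_line_act // -[k%:~R]/(k%:R : R) addNr orbit_line0.
have e2 : mdist (A (h ^+ k)%g y) (P (tau * k%:R)) = mdist y x.
  by rewrite /P orbit_line_nat // hact_isometry.
have := hyp.2 x y (A (h ^+ k)%g y) (P (tau * k%:R)).
rewrite lerBlDr ge_min => /orP[]; first by lra.
move: H1 H2; rewrite /gromov_product e1 e2 (metric_sym y x).
rewrite (metric_sym (P (- (tau * k%:R))) y).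
by rewrite (metric_sym (P (- (tau * k%:R))) x) in l2; lra.
Qed.

Variables (h : G) (lox : loxodromic A h).

Lemma conj_loxodromic k : loxodromic A (k * h * k^-1)%g.
Proof.
have [x [K [C [K1 C0 H]]]] := lox; exists (A k x), K, C; split => // m n.
have conj (i : int) : A (expgz (k * h * k^-1)%g i) (A k x) = A k (A (expgz h i) x).
  rewrite -!hactM; congr (A _ x).
  have nat (j : nat) : ((k * h * k^-1) ^+ j * k = k * h ^+ j)%g.
    elim: j => [|j IH]; first by rewrite !expg0 mul1g mulg1.
    by rewrite expgS expgSr -mulgA IH !mulgA mulgVK -!mulgA -expgS -expgSr.
  case: i => j /=; first exact: nat.
  by apply: (@mulgI _ ((k * h * k^-1) ^+ j.+1)%g); rewrite mulVKg mulgA nat mulgK.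
by rewrite !conj hact_isometry.
Qed.

Lemma conj_endpoints k (loxk : loxodromic A (k * h * k^-1)%g) :
  boundary2_set (endpoint_set loxk) = boundary2_set (boundary2_act A k (endpoint_set lox)).
Proof.
have [x _] := lox; have hX := hact_hyperbolic A.
have end_eq g g' (a b : boundary X) : attracting_fixed_point A g a ->
    attracting_fixed_point A g' b ->
    (forall n : nat, A (g' ^+ n)%g (A k x) = A k (A (g ^+ n)%g x)) ->
    b = boundary_act A k a.
  move=> [_ /(_ x) ga] [_ /(_ (A k x)) gb] E.
  apply/(asymptotic_limits hX gb (boundary_class_act A k ga)).
  rewrite (_ : (A k \o _) = (fun n => A (g' ^+ n)%g (A k x))).
    exact: boundary_converges gb.
  by apply/funext => n; rewrite /= E.
have conjX g n : A ((k * g * k^-1) ^+ n)%g (A k x) = A k (A (g ^+ n)%g x).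
  elim: n => [|n IH]; first by rewrite !expg0 !hact1.
  by rewrite !expgS !hactM IH hactK.
have [hm hp] := endpointsP lox; have [km kp] := endpointsP loxk.
rewrite boundary2_act_unordered /= -!/(repelling_end _) -!/(attracting_end _).
congr [set _; _]; last by apply: end_eq hp kp _ => n; exact: conjX.
apply: end_eq hm km _ => n; rewrite !invgM invgK mulgA; exact: conjX.
Qed.

Variables (x : X) (tau c delta : R).
Hypothesis hyp : @hyperbolic_with R X delta.
Hypothesis tau_gt0 : 0 < tau.
Local Notation P := (orbit_line A h x tau).
Hypothesis lineP : rough_line c P.
Hypothesis rig : rigid_ordered lox x tau.

(** Conjugating by a high power of h moves a half line that is coarsely fixed so
    that it covers the segment in the definition of rigidity. *)
Lemma rigid_half_line g (C : R) (s : R) : s = 1 \/ s = -1 ->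
  (forall m, 0 <= m -> mdist (P (s * m)) (A g (P (s * m))) <= C) ->
  stab_ordered lox g.
Proof.
move=> sE H; have [M M0 HM] := rig C.
have [N /(_ N (leqnn _)) HN] := ray_far tau_gt0 M.
have [n En] : exists n : int, tau * n%:~R = s * (tau * N%:R).
  case: sE => ->; first by exists N; rewrite mul1r.
  by exists (- N%:Z); rewrite mulN1r rmorphN mulrN.
apply: (@stab_ordered_sandwich _ _ _ _ _ lox g (- n) n); apply: HM.
have km m : - M <= m <= M ->
    mdist (P m) (A (expgz h (- n) * g * expgz h n)%g (P m)) <= C.
  move=> /andP[m1 m2]; rewrite mdist_conj // En.
  have ss : s * s = 1 by case: sE => ->; rewrite ?mulrNN mulr1.
  rewrite (_ : m + s * _ = s * (s * m + tau * N%:R)); last first.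
    by rewrite mulrDr [s * (s * m)]mulrA ss mul1r.
  by apply: H; case: sE => ->; rewrite ?mul1r ?mulN1r; lra.
by split; apply: km; apply/andP; split; lra.
Qed.

Lemma rigid_stab_attracting g :
  boundary_act A g (attracting_end lox) = attracting_end lox -> stab_ordered lox g.
Proof.
move=> gp; have [_ ep] := has_ends_orbit lox x tau_gt0.
have [_ gep] := has_ends_act A g (has_ends_orbit lox x tau_gt0).
have [|C HC] := same_end_bounded hyp tau_gt0 lineP (rough_line_act A g lineP).
  by apply/(asymptotic_limits (hact_hyperbolic A) ep gep).
apply: (@rigid_half_line g C 1); first by left.
by move=> m m0; rewrite !mul1r; exact: HC.
Qed.

Lemma rigid_stab_repelling g :
  boundary_act A g (repelling_end lox) = repelling_end lox -> stab_ordered lox g.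
Proof.
move=> gp; have [em _] := has_ends_orbit lox x tau_gt0.
have [gem _] := has_ends_act A g (has_ends_orbit lox x tau_gt0).
have [|C HC] := same_end_bounded hyp tau_gt0 (rough_line_rev lineP) (rough_line_flip lineP g).
  by apply/(asymptotic_limits (hact_hyperbolic A) em gem).
apply: (@rigid_half_line g C (-1)); first by right.
by move=> m m0; rewrite !mulN1r; exact: HC.
Qed.

Lemma rigid_stab_ends :
  stab (boundary_act A) (repelling_end lox) = stab_ordered lox /\
  stab (boundary_act A) (attracting_end lox) = stab_ordered lox.
Proof.
split; apply/seteqP; split=> g.
- exact: rigid_stab_repelling.
- by move=> /stab_orderedP[].
- exact: rigid_stab_attracting.
- by move=> /stab_orderedP[].
Qed.

(** If g shares an endpoint with h, it fixes both endpoints of h, and a loxodromic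
    element has no fixed points besides its own endpoints. *)
Lemma rigid_dichotomy g (loxg : loxodromic A g) :
  boundary2_set (endpoint_set loxg) = boundary2_set (endpoint_set lox) \/
  boundary2_set (endpoint_set loxg) `&` boundary2_set (endpoint_set lox) = set0.
Proof.
have [|] := pselect (exists a, (boundary2_set (endpoint_set loxg) `&`
    boundary2_set (endpoint_set lox)) a); last first.
  by move=> /forallNP H; right; apply/seteqP; split => // a /H.
move=> [a []]; rewrite /= -!/(repelling_end _) -!/(attracting_end _) => ag ah; left.
have [Eg1 Eg2] := (stab_orderedP loxg g).1 (stab_ordered_self loxg).
have ga : boundary_act A g a = a by case: ag => ->.
have /stab_orderedP[E1 E2] : stab_ordered lox g.
  by case: ah ga => ->; [exact: rigid_stab_repelling|exact: rigid_stab_attracting].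
have := @ends_neq _ _ _ _ _ lox.
have [->|->] := loxodromic_fixed_points loxg E1;
  have [->|->] := loxodromic_fixed_points loxg E2 => //.
by rewrite setUC.
Qed.

Lemma rigid_conj_independent k : ~ stab_unordered lox k ->
  exists loxk : loxodromic A (k * h * k^-1)%g, independent lox loxk.
Proof.
move=> nk; exists (conj_loxodromic k).
have [E|] := rigid_dichotomy (conj_loxodromic k); last by rewrite setIC.
by case: nk; apply: boundary2_eq; rewrite -(conj_endpoints (conj_loxodromic k)) E.
Qed.

End FixedPoints.

(** * Equivalent characterizations of WWPD *)

Theorem mainTheorem3 (R : realType) (G : groupType) (X : metricType R)
    (A : hyperbolic_action G X) (h : G) (lox : loxodromic A h) :
  [<-> wwpd_finiteness lox;
       wwpd_discrete_unordered lox;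
       wwpd_discrete_ordered lox;
       wwpd_projection lox;
       wwpd_no_sequence_forall lox;
       wwpd_no_sequence_exists lox] /\
  (WWPD lox ->
   [/\ stab (boundary_act A) (repelling_end lox)
         = stab (boundary_act A) (attracting_end lox),
       stab (boundary_act A) (attracting_end lox) = stab_ordered lox,
       forall (g : G) (loxg : loxodromic A g),
         boundary2_set (endpoint_set loxg) = boundary2_set (endpoint_set lox) \/
         boundary2_set (endpoint_set loxg) `&` boundary2_set (endpoint_set lox)
           = set0 &
       forall k : G, ~ stab_unordered lox k ->
         exists loxk : loxodromic A (k * h * k^-1)%g, independent lox loxk]).
Proof.
have [x [tau [c [tau0 lineP]]]] := loxodromic_orbit_line lox.
have [delta hyp] := hyperbolic_const (hact_hyperbolic A) (inhabits x).
have rig := rigid_unordered_ordered hyp tau0 lineP.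
have from_forall H := rig lox (no_sequence_rigid hyp tau0 lineP H).
have from_exists H := from_forall (no_sequence_exists_forall x H).
have from_finite H := from_exists (finiteness_no_sequence H).
have to_finite := rigid_finiteness hyp tau0 lineP.
split.
  tfae.
  - by move=> /from_finite; exact: (rigid_discrete_unordered hyp tau0 lineP).
  - move=> /(discrete_unordered_rigid hyp tau0 lineP)/rig.
    exact: (rigid_discrete_ordered hyp tau0 lineP).
  - by move=> /(discrete_ordered_rigid hyp tau0 lineP); exact: (rigid_projection hyp tau0 lineP).
  - move=> /(projection_rigid tau0 lineP)/rig/to_finite/finiteness_no_sequence.
    exact: (no_sequence_exists_forall x).
  - by move=> /from_forall/to_finite/finiteness_no_sequence.
  - by move=> /from_exists/to_finite.
move=> /from_finite rigid; have [Em Ep] := rigid_stab_ends hyp tau0 lineP rigid.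
split=> //.
- by rewrite Em Ep.
- exact: (rigid_dichotomy hyp tau0 lineP rigid).
- exact: (rigid_conj_independent hyp tau0 lineP rigid).
Qed.
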